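(* Let $\mathbf{L}$ be a Koszul Lie algebra over a field $\mathbb{F}$ satisfying $\mathbf{h}(\mathbf{L})\leq1$. Then $\mathbf{L}$ is finite-dimensional and abelian.
   Context: $\mathbb{F}$ is an arbitrary field. An $\mathbb{N}$-graded Lie algebra $\mathbf{L}=\coprod_{k\geq1}\mathbf{L}_k$ satisfies $[\mathbf{L}_n,\mathbf{L}_m]\subseteq\mathbf{L}_{n+m}$; its entropy is $\mathbf{h}(\mathbf{L})=\limsup_{n\to\infty}\sqrt[n]{\dim(\mathbf{L}_n)}$. Its universal enveloping algebra $\mathcal{U}(\mathbf{L})$ is an $\mathbb{N}_0$-graded connected algebra (degree-$0$ part $\mathbb{F}\cdot1$). An $\mathbb{N}_0$-graded $\mathbb{F}$-algebra $\mathbf{A}$ is generated in degree $1$ if the canonical homomorphism from the tensor algebra $\mathbf{T}(\mathbf{A}_1)\to\mathbf{A}$ is surjective; it is then quadratic if the kernel of this map is generated, as a two-sided ideal, by its component in $\mathbf{A}_1\otimes\mathbf{A}_1$. It is of finite type if $\dim(\mathbf{A}_k)<\infty$ for all $k$. A quadratic algebra of finite type $\mathbf{A}$ is Koszul if $\mathrm{Ext}^{s,t}_{\mathbf{A}}(\mathbb{F},\mathbb{F})=0$ for $s\neq t$, where $s$ is the homological degree, $t$ is the internal degree induced by the grading of $\mathbf{A}$, and $\mathbb{F}=\mathbf{A}/\coprod_{k\ge1}\mathbf{A}_k$ is the trivial module. An $\mathbb{N}$-graded Lie algebra $\mathbf{L}$ is a Koszul Lie algebra if $\mathcal{U}(\mathbf{L})$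 is a Koszul algebra. *)

(* Defs.v *)
From HB Require Import structures.
From mathcomp Require Import all_boot all_order all_algebra.
From mathcomp Require Import all_classical all_reals all_analysis.

Set Implicit Arguments.
Unset Strict Implicit.
Unset Printing Implicit Defensive.

Import Order.TTheory GRing.Theory Num.Theory.
Local Open Scope classical_set_scope.
Local Open Scope ring_scope.

HB.mixin Record Lmodule_isLie (F : fieldType) L of GRing.Lmodule F L := {
  lie : L -> L -> L;
  lie_linearl : forall (y : L) (a : F) (u v : L),
    lie (a *: u + v) y = a *: lie u y + lie v y;
  lie_linearr : forall (x : L) (a : F) (u v : L),
    lie x (a *: u + v) = a *: lie x u + lie x v;
  lie_alt : forall x : L, lie x x = 0;
  lie_jacobi : forall x y z : L,
    lie x (lie y z) + lie y (lie z x) + lie z (lie x y) = 0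
}.

#[short(type="lieAlgType")]
HB.structure Definition LieAlgebra (F : fieldType) :=
  {L of GRing.Lmodule F L & Lmodule_isLie F L}.

Section LinearAlgebra.
Variables (F : fieldType) (V : lmodType F).

Definition lin_span_pred (S : set V) : {pred V} := fun x =>
  `[< exists n (c : 'I_n -> F) (v : 'I_n -> V),
        (forall i, S (v i)) /\ x = \sum_i c i *: v i >].

Lemma lin_span_closed (S : set V) : submod_closed (lin_span_pred S).
Proof.
split.
  apply/asboolP; exists 0%N, (fun _ => 0), (fun _ => 0).
  by split=> [[]//|]; rewrite big_ord0.
move=> a _ _ /asboolP[n [c [v [Sv ->]]]] /asboolP[m [d [w [Sw ->]]]].
apply/asboolP; exists (n + m)%N.
exists (fun i => match fintype.split i with inl j => a * c j | inr j => d j end).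
exists (fun i => match fintype.split i with inl j => v j | inr j => w j end).
split=> [i|]; first by case: (fintype.split i).
rewrite big_split_ord /= scaler_sumr.
congr (_ + _); apply: eq_bigr => i _.
  by rewrite (unsplitK (inl i)) scalerA.
by rewrite (unsplitK (inr i)).
Qed.

HB.instance Definition _ (S : set V) :=
  GRing.isSubmodClosed.Build F V (lin_span_pred S) (lin_span_closed S).

Definition lin_span (S : set V) : submodClosed V := lin_span_pred S.

Definition lin_indep n (v : 'I_n -> V) : Prop :=
  forall c : 'I_n -> F, \sum_i c i *: v i = 0 -> forall i, c i = 0.

Definition fin_dim (S : {pred V}) : Prop :=
  exists s : seq V, {subset s <= S} /\ {subset S <= lin_span [set` s]}.

(* The dimension, with value +oo on infinite-dimensional subspaces. *)
Definition edim (R : realType) (S : {pred V}) : \bar R :=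
  ereal_sup [set x : \bar R | exists n (v : 'I_n -> V),
    [/\ forall i, v i \in S, lin_indep v & x = (n%:R)%:E]].

End LinearAlgebra.

(* A subspace regarded as a vector space in its own right. *)
Definition subspace_type (F : fieldType) (V : lmodType F) (S : submodClosed V) :=
  {x : V | x \in S}.

Section SubspaceType.
Variables (F : fieldType) (V : lmodType F) (S : submodClosed V).
HB.instance Definition _ := SubChoice.on (subspace_type S).
HB.instance Definition _ := [SubChoice_isSubLmodule of subspace_type S by <:].
End SubspaceType.

(* V is the internal direct sum of the gr k, which are subgroups (or subspaces)
   by their type at every use below. *)
Definition is_grading (V : zmodType) (gr : nat -> {pred V}) : Prop :=
  (forall x : V, exists n (y : nat -> V),
     (forall k, y k \in gr k) /\ x = \sum_(k < n) y k)
  /\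
  (forall n (y : nat -> V), (forall k, y k \in gr k) ->
     \sum_(k < n) y k = 0 -> forall k, (k < n)%N -> y k = 0).

Record graded_lie (F : fieldType) (L : lieAlgType F)
    (gr : nat -> submodClosed L) : Prop := GradedLie {
  graded_lie_sum : is_grading (fun k => gr k);
  (* the grading starts in degree 1 *)
  graded_lie0 : forall x, x \in gr 0%N -> x = 0;
  graded_lie_lie : forall n m x y,
    x \in gr n -> y \in gr m -> lie x y \in gr (n + m)%N
}.

Definition entropy (R : realType) (F : fieldType) (L : lieAlgType F)
    (gr : nat -> submodClosed L) : \bar R :=
  limn_esup (fun n : nat => (edim R (gr n) `^ (n%:R^-1))%E).

Definition abelian_lie (F : fieldType) (L : lieAlgType F) : Prop :=
  forall x y : L, lie x y = 0.

Record graded_alg (F : fieldType) (A : algType F)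
    (gr : nat -> submodClosed A) : Prop := GradedAlg {
  graded_alg_sum : is_grading (fun k => gr k);
  graded_alg1 : 1 \in gr 0%N;
  graded_algM : forall n m x y,
    x \in gr n -> y \in gr m -> x * y \in gr (n + m)%N
}.

Section TensorAlgebra.
Variables (F : fieldType) (V : lmodType F) (T : algType F).
Variable j : {linear V -> T}.

Definition is_tensor_algebra : Prop :=
  forall (B : algType F) (f : {linear V -> B}),
    (exists g : {lrmorphism T -> B}, forall v, g (j v) = f v) /\
    (forall g h : {lrmorphism T -> B},
       (forall v, g (j v) = f v) -> (forall v, h (j v) = f v) -> g =1 h).

(* The component of the tensor algebra spanned by the v (x) w. *)
Definition tensor2 : submodClosed T :=
  lin_span [set x | exists v w, x = j v * j w].

End TensorAlgebra.

Definition two_sided_ideal (T : pzRingType) (S : set T) : set T :=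
  [set x | exists n (a s b : 'I_n -> T),
     (forall i, S (s i)) /\ x = \sum_i a i * s i * b i].

(* The existential over T only names the tensor algebra of gr 1, which is
   unique up to unique isomorphism; the same applies to the enveloping algebra
   in koszul_lie. *)
Definition quadratic (F : fieldType) (A : algType F)
    (gr : nat -> submodClosed A) : Prop :=
  exists (T : algType F) (j : {linear subspace_type (gr 1%N) -> T})
         (pi : {lrmorphism T -> A}),
    [/\ is_tensor_algebra j,
        (forall v, pi (j v) = val v),
        (forall a, exists x, pi x = a)
      & forall x, pi x = 0 <->
          two_sided_ideal [set y | y \in tensor2 j /\ pi y = 0] x].

Section GradedModules.
Variables (F : fieldType) (A : algType F) (gr : nat -> submodClosed A).

(* N_0-graded left modules. This category contains the trivial module, has
   enough projectives, and these are projective as ungraded modules too, so it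
   suffices for computing Ext of the trivial module. *)
Record gmod := GMod {
  gmod_sort :> lmodType A;
  gmod_comp : nat -> zmodClosed gmod_sort;
  gmod_sum : is_grading (fun k => gmod_comp k);
  gmod_act : forall n m (a : A) (x : gmod_sort),
    a \in gr n -> x \in gmod_comp m -> a *: x \in gmod_comp (n + m)%N
}.

(* f lowers the internal degree by t; degree-preserving maps are the case
   t = 0. *)
Definition hom_degree (t : nat) (M N : gmod) (f : M -> N) : Prop :=
  forall i x, x \in gmod_comp M i ->
    ((t <= i)%N -> f x \in gmod_comp N (i - t)%N) /\ ((i < t)%N -> f x = 0).

Definition projective (P : lmodType A) : Prop :=
  forall (M N : lmodType A) (p : {linear M -> N}) (f : {linear P -> N}),
    (forall y, exists x, p x = y) ->
    exists g : {linear P -> M}, forall x, p (g x) = f x.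

Record proj_resolution (M : gmod) := ProjResolution {
  res :> nat -> gmod;
  res_d : forall s, {linear res s.+1 -> res s};
  res_aug : {linear res 0%N -> M};
  res_proj : forall s, projective (res s);
  res_d_deg : forall s, hom_degree 0 (res_d s);
  res_aug_deg : hom_degree 0 res_aug;
  res_aug_surj : forall y, exists x, res_aug x = y;
  res_exact0 : forall x, res_aug x = 0 <-> exists y, x = res_d 0%N y;
  res_exact : forall s x, res_d s x = 0 <-> exists y, x = res_d s.+1 y
}.

Definition is_cocycle (M N : gmod) (P : proj_resolution M) (s : nat)
    (f : P s -> N) : Prop :=
  forall x, f (res_d P s x) = 0.

Definition is_coboundary (M N : gmod) (P : proj_resolution M) (t s : nat) :
    (P s -> N) -> Prop :=
  match s return (P s -> N) -> Prop with
  | 0 => fun f => forall x, f x = 0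
  | s'.+1 => fun f => exists g : {linear P s' -> N},
      hom_degree t g /\ forall x, f x = g (res_d P s' x)
  end.

(* Ext^{s,t}_A(M, N) = 0: the degree-t part of the cohomology H^s(Hom_A(P, N))
   vanishes. This does not depend on the projective resolution P. *)
Definition Ext_vanishes (s t : nat) (M N : gmod) : Prop :=
  forall (P : proj_resolution M) (f : {linear P s -> N}),
    hom_degree t f -> is_cocycle f -> is_coboundary t f.

Definition augmentation_ideal : set A :=
  [set a | exists n (y : nat -> A),
     (forall k, y k \in gr k.+1) /\ a = \sum_(k < n) y k].

(* K is A / augmentation_ideal, concentrated in degree 0. *)
Definition is_trivial_gmod (K : gmod) : Prop :=
  (exists q : {linear A^o -> K},
     (forall y, exists a, q a = y) /\
     (forall a, q a = 0 <-> augmentation_ideal a)) /\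
  (forall x, x \in gmod_comp K 0%N).

Record koszul_alg : Prop := KoszulAlg {
  koszul_graded : graded_alg gr;
  koszul_quadratic : quadratic gr;
  koszul_finite_type : forall k, fin_dim (gr k);
  koszul_Ext : forall K : gmod, is_trivial_gmod K ->
    forall s t : nat, s <> t -> Ext_vanishes s t K K
}.

End GradedModules.

Section EnvelopingAlgebra.
Variables (F : fieldType) (L : lieAlgType F).

Definition is_lie_hom (A : algType F) (f : L -> A) : Prop :=
  forall x y, f (lie x y) = f x * f y - f y * f x.

Variables (U : algType F) (iota : {linear L -> U}).

Definition is_enveloping_algebra : Prop :=
  is_lie_hom iota /\
  forall (B : algType F) (f : {linear L -> B}), is_lie_hom f ->
    (exists g : {lrmorphism U -> B}, forall x, g (iota x) = f x) /\
    (forall g h : {lrmorphism U -> B},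
       (forall x, g (iota x) = f x) -> (forall x, h (iota x) = f x) -> g =1 h).

(* The degree-n component is spanned by the products of homogeneous elements
   of L of total degree n. *)
Definition enveloping_grading (gr : nat -> submodClosed L) (n : nat) :
    submodClosed U :=
  lin_span [set u | exists s : seq (nat * L),
    [/\ forall p, p \in s -> p.2 \in gr p.1,
        sumn [seq p.1 | p <- s] = n
      & u = \prod_(p <- s) iota p.2]].

End EnvelopingAlgebra.

Definition koszul_lie (F : fieldType) (L : lieAlgType F)
    (gr : nat -> submodClosed L) : Prop :=
  exists (U : algType F) (iota : {linear L -> U}),
    is_enveloping_algebra iota /\ koszul_alg (enveloping_grading iota gr).

(* Main.v *)
(** Let A = U(L), u_n = dim A_n and d = u_1 = dim L_1.  Koszulity makes the
    minimal resolution of the trivial module linear; if it has m_s generators in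
    homological degree s, then q(t) * sum_n u_n t^n = 1 for
    q(t) = sum_s (-1)^s m_s t^s.  These generators are tensors of degree s over
    L_1 which are alternating, because A maps onto the polynomial ring on L_1;
    hence m_s = 0 for s > d.

    By the spanning half of the Poincare-Birkhoff-Witt theorem, entropy at most
    one makes sum_n u_n t^n converge for 0 < t < 1, and the map onto the
    polynomial ring bounds it below by (1 - t)^-d.  So 0 <= q(t) <= (1 - t)^d on
    (0, 1), and as deg q <= d and q(0) = 1 this forces q = (1 - t)^d.

    Now u_2 = d(d + 1)/2, so A_2 is the space of quadratic polynomials and
    elements of L_1 commute in A.  Since L_2 embeds in A, [L_1, L_1] = 0.  If
    L_k is the first nonzero component with k >= 2, projection to L_k is then a
    Lie homomorphism to an abelian Lie algebra killing L_1, contradicting that A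
    is generated by L_1. *)

(* The Koszul hypothesis speaks of every projective resolution, so it may be tested on one built for
   the purpose. Free covers are chosen for arbitrary modules, before anything is known about their
   generators; vanishing of off-diagonal Ext then shows by induction that the s-th syzygies are
   generated in degree s. The differentials thus become matrices over L_1, and d d = 0 is a family
   of quadratic relations of A. Their images in the polynomial ring force the coefficients to
   alternate, diagonal included, so the argument covers characteristic 2. Linear independence in the
   Poincare-Birkhoff-Witt theorem is replaced by explicit representations of A: the polynomial ring
   for the lower bound, and a nilpotent extension F + V + W that detects single components of L.
   Since the components of L are not known to be finite-dimensional at the outset, the upper bound
   counts their images in A, which are. Convergence is only available for 0 < t < 1, so identities
   between series are first proved for partial sums, and the behaviour at t = 1 is extracted from a
   bound on the open interval. *)
Require Import Defs.
From HB Require Import structures.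
From mathcomp Require Import all_boot all_order all_algebra.
From mathcomp Require Import all_classical all_reals all_analysis.
From mathcomp Require Import ring lra zify.
Import GRing.Theory.

Set Implicit Arguments.
Unset Strict Implicit.
Unset Printing Implicit Defensive.

Import Order.TTheory Num.Theory numFieldNormedType.Exports.
Local Open Scope classical_set_scope.
Local Open Scope ring_scope.

(** * Linear algebra *)

(* MathComp's submodClosed only records closure under addition and scaling. *)
Lemma submodB (K : pzRingType) (M : lmodType K) (S : submodClosed M) x y :
  x \in S -> y \in S -> x - y \in S.
Proof. by move=> xS yS; rewrite -scaleN1r rpredD ?rpredZ. Qed.

Lemma linear_ex (K : pzRingType) (V W : lmodType K) (f : V -> W) :
  linear f -> exists g : {linear V -> W}, forall x, g x = f x.
Proof.
move=> fl; pose fl' := GRing.isLinear.Build K V W *:%R f fl.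
by exists (HB.pack_for {linear V -> W} f fl').
Qed.

Section FiniteDimension.
Variables (F : fieldType) (V : lmodType F).
Implicit Type S : {pred V}.

(** Families are indexed by finite types, so that bases of direct sums and of free modules are
    indexed by sum and product types. *)
Definition indep (I : finType) (v : I -> V) : Prop :=
  forall c : I -> F, \sum_i c i *: v i = 0 -> forall i, c i = 0.

Definition lincomb (I : finType) (v : I -> V) (x : V) : Prop :=
  exists c : I -> F, x = \sum_i c i *: v i.

Definition is_basis S (I : finType) (v : I -> V) : Prop :=
  [/\ forall i, v i \in S, indep v & forall x, x \in S -> lincomb v x].

Definition has_dim S n : Prop := exists v : 'I_n -> V, is_basis S v.

Lemma lincombP (I : finType) (v : I -> V) x :
  reflect (lincomb v x) (x \in lin_span (range v)).
Proof.
apply: (iffP (asboolP _)) => [[n [c [w [wv ->]]]]|[c ->]].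
  have /choice[h hv] : forall i, exists j, v j = w i by move=> i; case: (wv i) => j _ <-;
    exists j.
  exists (fun j => \sum_(i | h i == j) c i).
  rewrite (partition_big h xpredT) //=; apply: eq_bigr => j _.
  by rewrite scaler_suml; apply: eq_bigr => i /eqP <-; rewrite hv.
exists #|I|, (fun i => c (enum_val i)), (fun i => v (enum_val i)); split.
  by move=> i; exists (enum_val i).
by rewrite (reindex_onto (@enum_val I xpredT) enum_rank) ?enum_rankK //=;
   [apply: eq_bigl => i; rewrite enum_valK eqxx | move=> i _; rewrite enum_rankK].
Qed.

Lemma lin_span_gen (S : set V) x : S x -> x \in lin_span S.
Proof.
move=> Sx; apply/asboolP; exists 1%N, (fun=> 1), (fun=> x).
by rewrite big_ord1 scale1r.
Qed.

Lemma lin_span_min (S : set V) (W : submodClosed V) :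
  (forall x, S x -> x \in W) -> {subset lin_span S <= W}.
Proof.
move=> SW x /asboolP[n [c [v [Sv ->]]]]; apply: rpred_sum => i _.
by apply: rpredZ; exact: SW.
Qed.

(** A coefficient matrix with more rows than columns has a nonzero left-kernel vector, which is a
    linear relation among the [w i]. *)
Lemma indep_card_le (I J : finType) (w : I -> V) (v : J -> V) :
  indep w -> (forall i, lincomb v (w i)) -> (#|I| <= #|J|)%N.
Proof.
move=> wI /choice[C wE]; rewrite leqNgt; apply/negP => ltJI.
pose M : 'M[F]_(#|I|, #|J|) := \matrix_(i, j) C (enum_val i) (enum_val j).
have : ~~ row_free M.
  by apply/negP => /eqP Mr; have := rank_leq_col M; rewrite Mr leqNgt ltJI.
rewrite -kermx_eq0 => /rowV0Pn[u /sub_kermxP uM /negP[]]; apply/eqP.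
have uv : \sum_i u 0 (enum_rank i) *: w i = 0.
  under eq_bigr => i _ do rewrite wE scaler_sumr.
  rewrite exchange_big big1 //= => j _.
  under eq_bigr => i _ do rewrite scalerA.
  rewrite -scaler_suml; have /rowP/(_ (enum_rank j)) := uM.
  rewrite !mxE => uMj; rewrite (_ : \sum_i _ = 0) ?scale0r //.
  rewrite -[RHS]uMj (reindex_onto (@enum_val I xpredT) enum_rank) /=; last first.
    by move=> i _; rewrite enum_rankK.
  by under eq_bigl => i do rewrite enum_valK eqxx; apply: eq_bigr => i _;
     rewrite mxE enum_rankK enum_valK.
by apply/rowP => i; rewrite mxE -[i]enum_valK (wI _ uv).
Qed.

Lemma has_dimP S (I : finType) (v : I -> V) : is_basis S v -> has_dim S #|I|.
Proof.
case=> vS vI vG; exists (v \o enum_val); split=> [i|c c0 i|x /vG[c ->]].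
- exact: vS.
- have : \sum_j c (enum_rank j) *: v j = 0.
    rewrite -[RHS]c0 (reindex_onto (@enum_val I xpredT) enum_rank) /=; last first.
      by move=> j _; rewrite enum_rankK.
    by under eq_bigl => j do rewrite enum_valK eqxx; apply: eq_bigr => j _; rewrite enum_valK.
  by move/vI/(_ (enum_val i)); rewrite enum_valK.
- exists (c \o enum_val); rewrite (reindex_onto (@enum_val I xpredT) enum_rank) /=;
  last first.
    by move=> j _; rewrite enum_rankK.
  by apply: eq_bigl => j; rewrite enum_valK eqxx.
Qed.

Lemma indep_le_dim S n (I : finType) (w : I -> V) :
  has_dim S n -> (forall i, w i \in S) -> indep w -> (#|I| <= n)%N.
Proof.
move=> [v [vS vI vG]] wS wI; rewrite -[n]card_ord.
by apply: (indep_card_le wI (v := v)) => i; apply: vG.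
Qed.

Lemma dim_le_span S n (I : finType) (v : I -> V) :
  has_dim S n -> (forall x, x \in S -> lincomb v x) -> (n <= #|I|)%N.
Proof.
move=> [w [wS wI _]] vG; rewrite -[n]card_ord.
by apply: (indep_card_le wI) => i; exact/vG/wS.
Qed.

Lemma has_dim_uniq S m n : has_dim S m -> has_dim S n -> m = n.
Proof.
move=> Sm Sn; have [v [vS vI _]] := Sm; have [w [wS wI _]] := Sn.
have := indep_le_dim Sn vS vI; have := indep_le_dim Sm wS wI.
by rewrite !card_ord => nm mn; apply/eqP; rewrite eqn_leq mn.
Qed.

Lemma indep_extend1 (I : finType) (v : I -> V) x :
  indep v -> ~ lincomb v x ->
  indep (fun i : I + unit => match i with inl i => v i | inr _ => x end).
Proof.
move=> vI nx c; rewrite big_sumType /= (big_pred1 tt); last by case.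
move=> c0.
have cx0 : c (inr tt) = 0.
  apply/eqP/negPn/negP => cn0; apply: nx.
  exists (fun i => - (c (inr tt))^-1 * c (inl i)).
  under eq_bigr => i _ do rewrite -scalerA.
  rewrite -scaler_sumr; move/eqP: c0; rewrite addr_eq0 => /eqP ->.
  by rewrite scalerN scaleNr opprK scalerA mulVf // scale1r.
by move: c0; rewrite cx0 scale0r addr0 => /vI cI [i|[]].
Qed.

(** Greedy extension: a vector of [S] outside the span enlarges the family, and the bound [N] makes
    this stop. The index type grows by [unit] each time, so [h] keeps track of the original
    vectors. *)
Lemma basis_extend S N (I : finType) (v : I -> V) :
  (forall (J : finType) (w : J -> V), (forall i, w i \in S) -> indep w -> (#|J| <= N)%N) ->
  (forall i, v i \in S) -> indep v ->
  exists (J : finType) (w : J -> V) (h : I -> J),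
    [/\ injective h, forall i, w (h i) = v i & is_basis S w].
Proof.
move=> bnd; have [k] := ubnP (N - #|I|); elim: k I v => // k IH I v ltk vS vI.
have [vG|nG] := pselect (forall x, x \in S -> lincomb v x).
  by exists I, v, id; split.
have [x [xS nx]] : exists x, x \in S /\ ~ lincomb v x.
  by apply: contrapT => nex; apply: nG => x xS; apply: contrapT => nx; apply: nex; exists x.
pose v' (i : I + unit) := match i with inl i => v i | inr _ => x end.
have v'S : forall i, v' i \in S by case.
have v'I : indep v' by exact: indep_extend1.
have ltI : (#|I| < N)%N by have := bnd _ _ v'S v'I; rewrite card_sum card_unit addn1.
have [|J [w [h [hi hw wB]]]] := IH _ _ _ v'S v'I.
  by rewrite card_sum card_unit; lia.
by exists J, w, (h \o inl); split=> [i j /hi[]|i|]; rewrite //= hw.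
Qed.

Lemma indep_void (v : void -> V) : indep v.
Proof. by move=> c _ []. Qed.

Lemma has_dim_exists S N :
  (forall (J : finType) (w : J -> V), (forall i, w i \in S) -> indep w -> (#|J| <= N)%N) ->
  exists2 n, has_dim S n & (n <= N)%N.
Proof.
move=> bnd; pose v (i : void) : V := match i with end.
have [||J [w [_ [_ _ wB]]]] := @basis_extend S N void v bnd; [by case | exact: indep_void |].
exists #|J|; first exact: has_dimP wB.
by case: wB => wS wI _; exact: bnd.
Qed.

Lemma has_dim_sub S S' n : {subset S <= S'} -> has_dim S' n ->
  exists2 m, has_dim S m & (m <= n)%N.
Proof.
move=> SS' Sn; apply: has_dim_exists => J w wS wI.
by apply: indep_le_dim Sn _ wI => i; exact/SS'/wS.
Qed.

Lemma has_dim_span S (I : finType) (v : I -> V) :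
  (forall x, x \in S -> lincomb v x) -> exists2 m, has_dim S m & (m <= #|I|)%N.
Proof.
move=> vG; apply: has_dim_exists => J w wS wI.
by apply: (indep_card_le wI) => i; exact/vG/wS.
Qed.

Lemma lincomb_seq (s : seq V) x :
  x \in lin_span [set` s] -> lincomb (fun i : 'I_(size s) => s`_i) x.
Proof.
move=> xs; apply/lincombP; move: x xs; apply: lin_span_min => x /= /(nthP 0)[i lti <-].
by apply: lin_span_gen; exists (Ordinal lti).
Qed.

Lemma has_dim_le_seq S n (s : seq V) :
  {subset S <= lin_span [set` s]} -> has_dim S n -> (n <= size s)%N.
Proof.
move=> Ss Sn; rewrite -[size s]card_ord.
by apply: (dim_le_span Sn) => x xS; exact: (lincomb_seq (Ss x xS)).
Qed.

Lemma fin_dimP S : fin_dim S <-> exists n, has_dim S n.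
Proof.
split=> [[s [_ Ss]]|[n [v [vS vI vG]]]].
  by have [n] := has_dim_span (fun x xS => lincomb_seq (Ss x xS)); exists n.
exists (map v (enum 'I_n)); split=> [x /mapP[i _ ->]//|x /vG /lincombP].
apply: lin_span_min => _ [i _ <-]; apply: lin_span_gen => /=.
by rewrite map_f // mem_enum.
Qed.

Lemma has_dim0 S : (forall x, x \in S -> x = 0) -> has_dim S 0.
Proof.
move=> S0; exists (fun=> 0); split=> [[]//|c _ []//|x /S0 ->].
by exists (fun=> 0); rewrite big_ord0.
Qed.

Lemma basis_coord S (I : finType) (v : I -> V) : is_basis S v ->
  exists c : V -> I -> F, (forall x, x \in S -> x = \sum_i c x i *: v i) /\
   (forall b : I -> F, forall i, c (\sum_j b j *: v j) i = b i).
Proof.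
move=> [vS vI vG].
have /choice[c cE] : forall x, exists b : I -> F, lincomb v x -> x = \sum_i b i *: v i.
  by move=> x; have [[b ->]|nx] := pselect (lincomb v x); [exists b | exists (fun=> 0)].
exists c; split=> [x /vG|b i]; first exact: cE.
apply/eqP; rewrite -subr_eq0; apply/eqP.
apply: (vI (fun i => c (\sum_j b j *: v j) i - b i)).
under eq_bigr => j _ do rewrite scalerBl.
rewrite big_split /= sumrN -cE ?subrr //; by exists b.
Qed.

(* The coordinates extend to the ambient space only along a linear projection
   onto S. *)
Lemma basis_coord_linear (S : submodClosed V) (I : finType) (v : I -> V)
    (p : {linear V -> V}) : is_basis S v -> (forall x, p x \in S) ->
  exists c : I -> {linear V -> F^o},
    forall x, p x = \sum_i (c i x : F) *: v i.
Proof.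
move=> vB pS; have [vS vI vG] := vB; have [c [cE cU]] := basis_coord vB.
have cl i : linear (fun x => c (p x) i : F^o).
  move=> a x y; rewrite linearP {1}(cE _ (pS x)) {1}(cE _ (pS y)).
  rewrite scaler_sumr -big_split /=.
  under eq_bigr => j _ do rewrite scalerA -scalerDl.
  by rewrite cU.
have /choice[c' c'E] i := linear_ex (cl i).
by exists c' => x; rewrite {1}(cE _ (pS x)); apply: eq_bigr => i _; rewrite c'E.
Qed.

End FiniteDimension.

Section Exactness.
Variables (F : fieldType) (V1 V2 V3 : lmodType F).
Variables (f : {linear V1 -> V2}) (g : {linear V2 -> V3}).
Variables (S1 : {pred V1}) (S2 : {pred V2}) (S3 : {pred V3}).

Lemma has_dim_exact a c : injective f ->
  (forall k x y, x \in S2 -> y \in S2 -> k *: x + y \in S2) ->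
  (forall x, x \in S2 /\ g x = 0 <-> exists2 y, y \in S1 & x = f y) ->
  (forall x, x \in S2 -> g x \in S3) ->
  (forall z, z \in S3 -> exists2 x, x \in S2 & g x = z) ->
  has_dim S1 a -> has_dim S3 c -> has_dim S2 (a + c).
Proof.
move=> fI S2lin ex gS gG [v [vS vI vG]] [w [wS wI wG]].
have /choice[w' w'P] : forall i, exists x, x \in S2 /\ g x = w i.
  by move=> i; have [x] := gG _ (wS i); exists x.
have fS y : y \in S1 -> f y \in S2 /\ g (f y) = 0 by move=> yS; apply/ex; exists y.
pose u (i : 'I_a + 'I_c) := match i with inl i => f (v i) | inr i => w' i end.
rewrite (_ : (a + c)%N = #|{: 'I_a + 'I_c}|); last by rewrite card_sum !card_ord.
apply: (@has_dimP _ _ _ _ u); split.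
- by case=> i /=; [case: (fS _ (vS i)) | case: (w'P i)].
- move=> b; rewrite big_sumType /= => b0.
  have br i : b (inr i) = 0.
    apply: (wI (b \o inr)); move: (congr1 g b0); rewrite linear0 linearD !linear_sum /=.
    rewrite big1 ?add0r => [g0|j _]; last by rewrite linearZ /= (fS _ (vS j)).2 scaler0.
    by rewrite -[RHS]g0; apply: eq_bigr => j _; rewrite linearZ /= (w'P j).2.
  case=> i //; apply: (vI (b \o inl)); apply: fI; rewrite linear0 -[RHS]b0.
  rewrite [X in _ + X]big1 => [|j _]; last by rewrite br scale0r.
  by rewrite addr0 linear_sum; apply: eq_bigr => j _; rewrite linearZ.
- move=> x xS; have [b bE] := wG _ (gS _ xS).
  have [|y yS yE] := (ex (x - \sum_i b i *: w' i)).1.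
    split.
      (* The given closure of [S2] yields the additive step through -x + ((x - y) + (x - z)) = x -
         (y + z). *)
      apply: (big_ind (fun z => x - z \in S2)) => [|y z xy xz|i _]; first by rewrite subr0.
        have := S2lin (-1) _ _ xS (S2lin 1 _ _ xy xz).
        by rewrite scale1r scaleN1r addrACA -!addrA addKr opprD.
      by have := S2lin (- b i) _ _ (w'P i).1 xS; rewrite scaleNr addrC.
    rewrite linearB bE linear_sum /=; apply/eqP; rewrite subr_eq0; apply/eqP.
    by apply: eq_bigr => i _; rewrite linearZ /= (w'P i).2.
  have [e eE] := vG _ yS.
  exists (fun i => match i with inl i => e i | inr i => b i end).
  rewrite big_sumType /= -[LHS](subrK (\sum_i b i *: w' i)) yE eE; congr (_ + _).
  by rewrite linear_sum; apply: eq_bigr => i _; rewrite linearZ.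
Qed.

Lemma has_dim_inj n : injective f -> (forall x, x \in S1 -> f x \in S2) ->
  has_dim S2 n -> exists2 m, has_dim S1 m & (m <= n)%N.
Proof.
move=> fI fS S2n; apply: has_dim_exists => J w wS wI.
apply: (indep_le_dim S2n (w := f \o w)) => [i|c c0]; first exact/fS/wS.
apply: wI; apply: fI; rewrite linear0 -[RHS]c0 linear_sum.
by apply: eq_bigr => i _; rewrite linearZ.
Qed.

End Exactness.

(** * Gradings *)

(** A degree shift by [d]. The first [d] terms are padded with zeros because truncated subtraction
    would repeat [z 0] there. *)
Lemma sum_shift (V : zmodType) (z : nat -> V) d N : 
  \sum_(n < d + N) (if (d <= n)%N then z (n - d)%N else 0) = \sum_(k < N) z k.
Proof.
rewrite big_split_ord /= big1 ?add0r => [|i _]; last by rewrite leqNgt ltn_ord.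
by apply: eq_bigr => i _; rewrite leq_addr addKn.
Qed.

Section Gradings.
Variables (V : zmodType) (gr : nat -> {pred V}).

Definition homog_decomp (x : V) (y : nat -> V) : Prop :=
  (forall k, y k \in gr k) /\
  exists n, (forall k, (n <= k)%N -> y k = 0) /\ x = \sum_(k < n) y k.

(** Homogeneous components, chosen classically. [homog_decomp_uniq] makes the choice canonical, so
    rules for [gproj] are proved by exhibiting a decomposition. *)
Definition gproj (x : V) : nat -> V := xget (fun=> 0) [set y | homog_decomp x y].

Hypothesis grZ : forall k, zmod_closed (gr k).
Hypothesis grG : is_grading gr.

Let gr0 k : 0 \in gr k. Proof. by case: (grZ k). Qed.
Let grB k x y : x \in gr k -> y \in gr k -> x - y \in gr k.
Proof. by case: (grZ k) => _; apply. Qed.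

Lemma sum_widen (y : nat -> V) n m : (n <= m)%N -> (forall k, (n <= k)%N -> y k = 0) ->
  \sum_(k < n) y k = \sum_(k < m) y k.
Proof.
move=> nm y0; rewrite -!(big_mkord xpredT) [RHS](big_cat_nat (n := n)) //=.
by rewrite [X in _ + X]big_nat_cond [X in _ + X]big1 ?addr0 // => k /andP[/andP[/y0]].
Qed.

Lemma homog_decomp_ex x : exists y, homog_decomp x y.
Proof.
case: (grG.1 x) => n [y [yg ->]]; exists (fun k => if (k < n)%N then y k else 0).
split=> [k|]; first by case: ifP.
exists n; split=> [k|]; first by rewrite leqNgt => /negbTE->.
by apply: eq_bigr => k _; rewrite ltn_ord.
Qed.

Lemma gprojP x : homog_decomp x (gproj x).
Proof. by case: xgetP => [y -> //|/=]; case: (homog_decomp_ex x) => y yP /(_ y). Qed.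

Lemma homog_decomp_uniq x y z : homog_decomp x y -> homog_decomp x z -> y =1 z.
Proof.
move=> [yg [n [yn xy]]] [zg [m [zm xz]]] k.
(* Including [k.+1] puts index [k] inside the summation range even when it lies beyond both
   supports. *)
have [kn|] := boolP (k < maxn (maxn n m) k.+1)%N; last by rewrite leq_max ltnSn orbT.
apply/eqP; rewrite -subr_eq0; apply/eqP.
apply: (grG.2 (maxn (maxn n m) k.+1) (fun k => y k - z k)) => // [j|]; first exact: grB.
by rewrite sumrB -(sum_widen _ yn) -?xy -?(sum_widen _ zm) -?xz ?subrr //; lia.
Qed.

Lemma gproj_mem x k : gproj x k \in gr k. Proof. exact: (gprojP x).1. Qed.

Lemma gproj_sum x : exists n, forall m, (n <= m)%N -> x = \sum_(k < m) gproj x k.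
Proof.
by case: (gprojP x) => _ [n [x0 xE]]; exists n => m /sum_widen<-.
Qed.

Lemma gproj_id k x j : x \in gr k -> gproj x j = if j == k then x else 0.
Proof.
move=> xk; move: j; apply: homog_decomp_uniq (gprojP x) _.
split=> [j|]; first by case: eqP => [->|].
exists k.+1; split=> [j kj|]; first by rewrite gtn_eqF.
rewrite big_ord_recr /= eqxx big1 ?add0r // => j _.
by rewrite ltn_eqF.
Qed.

Lemma gprojB x y k : gproj (x - y) k = gproj x k - gproj y k.
Proof.
move: k; apply: homog_decomp_uniq (gprojP (x - y)) _.
split=> [j|]; first by apply: grB; exact: gproj_mem.
have [_ [n [x0 xE]]] := gprojP x; have [_ [m [y0 yE]]] := gprojP y.
exists (maxn n m); split=> [k nmk|]; first by rewrite x0 ?y0 ?subrr //; lia.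
by rewrite sumrB -(sum_widen _ x0) -?(sum_widen _ y0) -?xE -?yE //; lia.
Qed.

Lemma gproj0 k : gproj 0 k = 0.
Proof. by rewrite -[X in gproj X](subrr 0) gprojB subrr. Qed.

Lemma gprojD x y k : gproj (x + y) k = gproj x k + gproj y k.
Proof.
have gN z : gproj (- z) k = - gproj z k by rewrite -sub0r gprojB gproj0 sub0r.
by rewrite -[y]opprK gprojB gN !opprK.
Qed.

End Gradings.

Section GradedMaps.
Variables (V W : zmodType) (gr : nat -> {pred V}) (gr' : nat -> {pred W}).
Hypothesis grZ : forall k, zmod_closed (gr k).
Hypothesis grG : is_grading gr.
Hypothesis grZ' : forall k, zmod_closed (gr' k).
Hypothesis grG' : is_grading gr'.

Lemma gproj_map (f : {additive V -> W}) x k :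
  (forall k x, x \in gr k -> f x \in gr' k) ->
  f (gproj gr x k) = gproj gr' (f x) k.
Proof.
move=> fg; move: k; apply: (homog_decomp_uniq grZ' grG' (x := f x));
  last exact: gprojP grZ' grG' _.
have [xg [n [x0 xE]]] := gprojP grZ grG x; split=> [j|]; first exact/fg/xg.
exists n; split=> [k /x0 ->|]; first by rewrite raddf0.
by rewrite {1}xE raddf_sum.
Qed.

End GradedMaps.

Section LinearGradings.
Variables (F : pzRingType) (V : lmodType F) (gr : nat -> submodClosed V).
Hypothesis grG : is_grading (fun k => gr k).

Lemma submod_zmod_closed (S : submodClosed V) : zmod_closed S.
Proof. by split=> [|x y xS yS]; [exact: rpred0 | exact: submodB]. Qed.

Let grZ k : zmod_closed (gr k). Proof. exact: submod_zmod_closed. Qed.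

Lemma gproj_linear k : linear (fun x => gproj (fun k => gr k) x k).
Proof.
move=> a x y; rewrite (gprojD grZ grG); congr (_ + _); move: k.
apply: (homog_decomp_uniq grZ grG (gprojP grZ grG _)).
have [xg [n [x0 xE]]] := gprojP grZ grG x; split=> [j|]; first exact/rpredZ/xg.
exists n; split=> [k /x0 ->|]; first by rewrite scaler0.
by rewrite {1}xE scaler_sumr.
Qed.

Lemma gproj_linear_ex k :
  exists p : {linear V -> V}, forall x, p x = gproj (fun k => gr k) x k.
Proof.
exact: linear_ex (gproj_linear k).
Qed.

End LinearGradings.

(** * Nilpotent test algebras for the enveloping algebra *)

Section SquareZeroExtension.
Variables (F : fieldType) (V W : lmodType F).

Record bilin := Bilin {
  bilin_fun :> V -> V -> W;
  bilin_l : forall y a u v, bilin_fun (a *: u + v) y = a *: bilin_fun u y + bilin_fun v y;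
  bilin_r : forall x a u v, bilin_fun x (a *: u + v) = a *: bilin_fun x u + bilin_fun x v
}.

(* The algebra F + V + W with V W = W V = W W = 0 and V V -> W given by b. *)
Definition nil3_alg (b : bilin) : Type := (F^o * V * W)%type.

Variable b : bilin.
Local Notation nil3 := (nil3_alg b).

Let bDl u v y : b (u + v) y = b u y + b v y.
Proof. by rewrite -[u]scale1r bilin_l !scale1r. Qed.
Let bDr x u v : b x (u + v) = b x u + b x v.
Proof. by rewrite -[u]scale1r bilin_r !scale1r. Qed.
Let b0l y : b 0 y = 0.
Proof. by apply: (addrI (b 0 y)); rewrite -bDl !addr0. Qed.
Let b0r x : b x 0 = 0.
Proof. by apply: (addrI (b x 0)); rewrite -bDr !addr0. Qed.
Let bZl a u y : b (a *: u) y = a *: b u y.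
Proof. by rewrite -[a *: u]addr0 bilin_l b0l addr0. Qed.
Let bZr a x u : b x (a *: u) = a *: b x u.
Proof. by rewrite -[a *: u]addr0 bilin_r b0r addr0. Qed.

HB.instance Definition _ := GRing.Lmodule.on nil3.

Definition nil3_mk (a : F) (v : V) (w : W) : nil3 := ((a, v), w).
Definition nil3_mul (x y : nil3) : nil3 :=
  let: ((a, v), w) := x in let: ((a', v'), w') := y in
  nil3_mk (a * a') (a *: v' + a' *: v) (a *: w' + a' *: w + b v v').
Definition nil3_one : nil3 := nil3_mk 1 0 0.

Lemma nil3_mulA : associative nil3_mul.
Proof.
case=> [[a1 v1] w1] [[a2 v2] w2] [[a3 v3] w3] /=; congr ((_, _), _) => /=.
- by rewrite mulrA.
- rewrite !scalerDr !scalerA addrA; congr (_ + _ + _).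
  by rewrite [a3 * a1]mulrC.
  by rewrite [a2 * a3]mulrC.
- rewrite !scalerDr !scalerA bDl bDr !bZl !bZr.
  rewrite [a3 * a1]mulrC [a3 * a2]mulrC.
  rewrite -!addrA; congr (_ + (_ + _)).
  by rewrite addrCA; congr (_ + _); rewrite addrA addrC.
Qed.

Lemma nil3_mul1l : left_id nil3_one nil3_mul.
Proof.
by case=> [[a v] w]; rewrite /= b0l mul1r !scale1r !scaler0 !addr0.
Qed.

Lemma nil3_mul1r : right_id nil3_one nil3_mul.
Proof.
by case=> [[a v] w]; rewrite /= b0r mulr1 !scale1r !scaler0 !add0r addr0.
Qed.

Lemma nil3_mulDl : left_distributive nil3_mul +%R.
Proof.
case=> [[a1 v1] w1] [[a2 v2] w2] [[a3 v3] w3]; congr ((_, _), _) => /=.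
- exact: mulrDl.
- by rewrite scalerDl scalerDr addrACA.
- by rewrite scalerDl scalerDr bDl [RHS]addrACA; congr (_ + _); rewrite addrACA.
Qed.

Lemma nil3_mulDr : right_distributive nil3_mul +%R.
Proof.
case=> [[a1 v1] w1] [[a2 v2] w2] [[a3 v3] w3]; congr ((_, _), _) => /=.
- exact: mulrDr.
- by rewrite scalerDl scalerDr addrACA.
- by rewrite scalerDl scalerDr bDr [RHS]addrACA; congr (_ + _); rewrite addrACA.
Qed.

Lemma nil3_one_neq0 : nil3_one != 0.
Proof. by apply/eqP => -[] /eqP; rewrite oner_eq0. Qed.

HB.instance Definition _ := GRing.Zmodule_isNzRing.Build nil3
  nil3_mulA nil3_mul1l nil3_mul1r nil3_mulDl nil3_mulDr nil3_one_neq0.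

Lemma nil3_scaleAl (k : F) (x y : nil3) : k *: (x * y) = (k *: x) * y.
Proof.
case: x y => [[a1 v1] w1] [[a2 v2] w2]; congr ((_, _), _) => /=.
- exact: mulrA.
- by rewrite scalerDr !scalerA [k * a2]mulrC.
- by rewrite !scalerDr bZl !scalerA [k * a2]mulrC.
Qed.

HB.instance Definition _ := GRing.Lmodule_isLalgebra.Build F nil3 nil3_scaleAl.

Lemma nil3_scaleAr (k : F) (x y : nil3) : k *: (x * y) = x * (k *: y).
Proof.
case: x y => [[a1 v1] w1] [[a2 v2] w2]; congr ((_, _), _) => /=.
- exact: mulrCA.
- by rewrite scalerDr !scalerA [k * a1]mulrC.
- by rewrite !scalerDr bZr !scalerA [k * a1]mulrC.
Qed.

HB.instance Definition _ := GRing.Lalgebra_isAlgebra.Build F nil3 nil3_scaleAr.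

(** On elements without scalar part the commutator sees only the antisymmetrization of [b]; this is
    what makes Lie homomorphisms into [nil3] easy to produce. *)
Lemma nil3_commutator (v v' : V) (w w' : W) :
  nil3_mk 0 v w * nil3_mk 0 v' w' - nil3_mk 0 v' w' * nil3_mk 0 v w
    = nil3_mk 0 0 (b v v' - b v' v).
Proof.
apply/eqP; rewrite subr_eq; apply/eqP; congr ((_, _), _) => /=.
- by rewrite !mul0r addr0.
- by rewrite !scale0r !addr0.
- by rewrite !scale0r !add0r subrK.
Qed.

End SquareZeroExtension.

(** * Graded modules and free covers *)

Section FreeModules.
Variables (A : nzRingType) (X : choiceType).

Definition finsupp_pred : {pred (X -> A^o)} := fun f =>
  `[< exists s : seq X, forall x, x \notin s -> f x = 0 >].

Lemma finsupp_closed : submod_closed finsupp_pred.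
Proof.
split=> [|a f g /asboolP[s fs] /asboolP[t gt]]; apply/asboolP.
  by exists [::].
exists (s ++ t) => x; rewrite mem_cat negb_or => /andP[/fs fx /gt gx].
by change (a *: f x + g x = 0); rewrite fx gx scaler0 addr0.
Qed.

HB.instance Definition _ :=
  GRing.isSubmodClosed.Build A (X -> A^o) finsupp_pred finsupp_closed.

Definition freemod : Type := {f : X -> A^o | f \in finsupp_pred}.
HB.instance Definition _ := SubChoice.on freemod.
HB.instance Definition _ := [SubChoice_isSubLmodule of freemod by <:].

Implicit Type f : freemod.

Definition fcoef f (x : X) : A := val f x.

Lemma freemod_supp f : exists s : seq X, uniq s /\ forall x, x \notin s -> fcoef f x = 0.
Proof.
have /asboolP[s fs] := valP f; exists (undup s); split; first exact: undup_uniq.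
by move=> x; rewrite mem_undup; exact: fs.
Qed.

Lemma freemodD f g x : fcoef (f + g) x = fcoef f x + fcoef g x.
Proof. by rewrite /fcoef raddfD. Qed.

Lemma freemodZ a f x : fcoef (a *: f) x = a * fcoef f x.
Proof. by rewrite /fcoef linearZ. Qed.

Lemma freemodB f g x : fcoef (f - g) x = fcoef f x - fcoef g x.
Proof. by rewrite /fcoef raddfB. Qed.

Lemma freemod0 x : fcoef (0 : freemod) x = 0.
Proof. by rewrite /fcoef raddf0. Qed.

Lemma freemod_sum (I : Type) (r : seq I) (P : pred I) (g : I -> freemod) x :
  fcoef (\sum_(i <- r | P i) g i) x = \sum_(i <- r | P i) fcoef (g i) x.
Proof.
by elim/big_rec2: _ => [|i y z _ <-]; rewrite ?freemod0 ?freemodD.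
Qed.

Lemma freemod_ext f g : (forall x, fcoef f x = fcoef g x) -> f = g.
Proof. by move=> fg; apply/val_inj/funext. Qed.

Lemma freemod_ex (f : X -> A) (s : seq X) : (forall x, x \notin s -> f x = 0) ->
  exists g : freemod, forall x, fcoef g x = f x.
Proof.
move=> fs; have fP : (f : X -> A^o) \in finsupp_pred by apply/asboolP; exists s.
by exists (@exist _ (fun h : X -> A^o => h \in finsupp_pred) f fP).
Qed.

Section Extension.
Variables (M : lmodType A) (phi : X -> M).

(** The universal map sending the generator [x] to [phi x]; by [freemod_evalE] its value does not
    depend on the chosen support. *)
Definition freemod_eval f : M :=
  \sum_(x <- sval (cid (freemod_supp f))) fcoef f x *: phi x.

Lemma freemod_evalE f (s : seq X) : uniq s -> (forall x, x \notin s -> fcoef f x = 0) ->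
  freemod_eval f = \sum_(x <- s) fcoef f x *: phi x.
Proof.
move=> us fs; rewrite /freemod_eval; case: cid => t /= [ut ft].
rewrite (bigID (fun x => fcoef f x == 0)) /= big1 ?add0r => [|x /eqP->];
  last by rewrite scale0r.
rewrite [RHS](bigID (fun x => fcoef f x == 0)) /= [X in _
  = X + _]big1 ?add0r => [|x /eqP->]; last by rewrite scale0r.
rewrite -[LHS]big_filter -[RHS]big_filter; apply: perm_big; apply: uniq_perm;
  rewrite ?filter_uniq // => x.
rewrite !mem_filter; have [//|fx] := eqVneq (fcoef f x) 0.
have xs : x \in s by apply: contraNT fx => /fs/eqP.
have xt : x \in t by apply: contraNT fx => /ft/eqP.
by rewrite xs xt.
Qed.

Lemma freemod_eval_linear : linear freemod_eval.
Proof.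
move=> a f g; have [s [us fs]] := freemod_supp f; have [t [ut gt]] := freemod_supp g.
have st x : x \notin undup (s ++ t) -> fcoef f x = 0 /\ fcoef g x = 0.
  by rewrite mem_undup mem_cat negb_or => /andP[/fs -> /gt ->].
rewrite !(@freemod_evalE _ (undup (s ++ t))) ?undup_uniq //.
- rewrite scaler_sumr -big_split; apply: eq_bigr => x _.
  by rewrite freemodD freemodZ scalerDl scalerA.
- by move=> x /st[].
- by move=> x /st[].
- by move=> x /st[fx gx]; rewrite freemodD freemodZ fx gx mulr0 addr0.
Qed.

End Extension.

Definition freemod_delta_fun (x : X) : X -> A^o := fun y => if y == x then 1 else 0.

Lemma freemod_delta_subproof x : freemod_delta_fun x \in finsupp_pred.
Proof.
apply/asboolP; exists [:: x] => y; rewrite inE /freemod_delta_fun.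
by case: eqP.
Qed.

Definition freemod_delta x : freemod :=
  @exist _ (fun h : X -> A^o => h \in finsupp_pred) _ (freemod_delta_subproof x).

Lemma freemod_deltaE x y : fcoef (freemod_delta x) y = if y == x then 1 else 0.
Proof. by []. Qed.

Lemma freemod_eval_delta (M : lmodType A) (phi : X -> M) x :
  freemod_eval phi (freemod_delta x) = phi x.
Proof.
rewrite (@freemod_evalE _ _ _ [:: x]) // => [|y].
  by rewrite big_seq1 freemod_deltaE eqxx scale1r.
by rewrite inE freemod_deltaE => /negbTE->.
Qed.

Lemma freemod_decomp f : f = freemod_eval freemod_delta f.
Proof.
have [s [us fs]] := freemod_supp f; rewrite (freemod_evalE _ us fs).
apply: freemod_ext => x; rewrite freemod_sum.
under eq_bigr => y _ do rewrite freemodZ freemod_deltaE.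
have [xs|xs] := boolP (x \in s); last first.
  rewrite fs // big1_seq // => y /andP[_ ys].
  by case: eqP => [xy|_]; [rewrite xy ys in xs | rewrite mulr0].
rewrite (bigD1_seq x) //= eqxx mulr1 big1 ?addr0 // => y yx.
by rewrite eq_sym (negbTE yx) mulr0.
Qed.

Lemma freemod_linearE (M : lmodType A) (g : {linear freemod -> M}) f :
  g f = freemod_eval (g \o freemod_delta) f.
Proof.
rewrite {1}[f]freemod_decomp.
have [s [us fs]] := freemod_supp f; rewrite !(freemod_evalE _ us fs) linear_sum.
by apply: eq_bigr => x _; rewrite linearZ.
Qed.

End FreeModules.

Lemma freemod_projective (F : fieldType) (A : algType F) (X : choiceType) :
  projective (freemod A X : lmodType A).
Proof.
move=> M N p f pS; have /choice[h hE] := pS.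
have [g gE] := linear_ex (freemod_eval_linear (fun x => h (f (freemod_delta A x)))).
exists g => x; rewrite gE [RHS]freemod_linearE.
have [s [us xs]] := freemod_supp x; rewrite !(freemod_evalE _ us xs) linear_sum.
by apply: eq_bigr => y _; rewrite linearZ /= hE.
Qed.

Section GradedCategory.
Variables (F : fieldType) (A : algType F) (gr : nat -> submodClosed A).
Hypothesis hA : graded_alg gr.

Let grZ k : zmod_closed (gr k). Proof. exact: submod_zmod_closed. Qed.
Let grG : is_grading (fun k => gr k). Proof. exact: graded_alg_sum hA. Qed.

Local Notation gmod := (gmod gr).

Lemma gcomp_zmod (M : gmod) k : zmod_closed (gmod_comp M k).
Proof. by split=> [|x y xM yM]; [exact: rpred0 | exact: rpredB]. Qed.

Section FreeGradedModule.
Variables (X : choiceType) (deg : X -> nat).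

(** The shifted grading with generator [x] in degree [deg x]. Without the case split, truncated
    subtraction would admit degree-0 coefficients on generators of degree above [n]. *)
Definition free_comp (n : nat) : {pred freemod A X} := fun f =>
  `[< forall x, if (deg x <= n)%N then is_true (fcoef f x \in gr (n - deg x)%N) else
    fcoef f x = 0 >].

Lemma free_compP n (f : freemod A X) :
  reflect (forall x, if (deg x <= n)%N then is_true (fcoef f x \in gr (n - deg x)%N) else
    fcoef f x = 0)
    (f \in free_comp n).
Proof. exact: asboolP. Qed.

Lemma free_comp_zmod n : zmod_closed (free_comp n).
Proof.
split=> [|f g /free_compP fc /free_compP gc]; apply/free_compP => x.
  by rewrite freemod0 rpred0; case: ifP.
rewrite freemodB; have := fc x; have := gc x.
by case: ifP => _; [move=> *; exact: submodB | move=> -> ->; rewrite subrr].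
Qed.

HB.instance Definition _ n :=
  GRing.isZmodClosed.Build (freemod A X) (free_comp n) (free_comp_zmod n).

Lemma seq_bound (T : eqType) (s : seq T) (P : T -> nat -> Prop) :
  (forall x n m, (n <= m)%N -> P x n -> P x m) -> (forall x, exists n, P x n) ->
  exists n, forall x, x \in s -> P x n.
Proof.
move=> Pm Pe; elim: s => [|x s [n sn]]; first by exists 0%N.
have [m xm] := Pe x; exists (maxn m n) => y; rewrite inE => /orP[/eqP->|/sn ys].
  exact: Pm _ (leq_maxl _ _) xm.
exact: Pm _ (leq_maxr _ _) ys.
Qed.

Lemma free_comp_grading : is_grading free_comp.
Proof.
split=> [f|N y yc y0 n nN].
- have [s [us fs]] := freemod_supp f.
  pose g n x := if (deg x <= n)%N then gproj (fun k => gr k) (fcoef f x) (n - deg x) else 0.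
  have /choice[h hE] n : exists h : freemod A X, forall x, fcoef h x = g n x.
    apply: (freemod_ex (s := s)) => x /fs fx.
    by rewrite /g fx gproj0 //; case: ifP.
  pose Q x n := (forall k, (n <= k)%N ->
    fcoef f x = \sum_(j < k) gproj (fun k => gr k) (fcoef f x) j).
  have [|x|n nP] := @seq_bound _ s Q.
  + by move=> x n m nm xn k mk; apply: xn; exact: leq_trans nm mk.
  + by have [n nE] := gproj_sum grZ grG (fcoef f x); exists n.
  have [||D DP] := @seq_bound _ s (fun x n => (deg x <= n)%N).
  + by move=> x n' m nm xn; exact: leq_trans xn nm.
  + by move=> x; exists (deg x).
  (* [D] bounds the degrees of the generators in the support and [n] the degrees of their
     coefficients, so [D + n] components suffice. *)
  exists (D + n)%N, h; split=> [k|].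
    apply/free_compP => x; rewrite hE /g; case: leqP => // _; exact: (gproj_mem grZ grG).
  apply: freemod_ext => x; rewrite freemod_sum.
  under eq_bigr => k _ do rewrite hE /g.
  have [xs|xs] := boolP (x \in s); last first.
    by rewrite fs // big1 // => k _; rewrite gproj0 //; case: ifP.
  have -> : (D + n = deg x + (D + n - deg x))%N by have := DP _ xs; lia.
  rewrite (sum_shift (gproj (fun k => gr k) (fcoef f x))).
  by apply: nP => //; have := DP _ xs; lia.
- apply: freemod_ext => x; rewrite freemod0.
  have := free_compP _ _ (yc n) x; case: ifP => // dn _.
  (* Coefficientwise the claim is directness of the grading of [A], once the shift by [deg x] is
     undone. *)
  pose z k := fcoef (y (k + deg x)%N) x.
  suff : z (n - deg x)%N = 0 by rewrite /z subnK.
  apply: (grG.2 (N - deg x)%N z) => [k||]; last by lia.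
    by have := free_compP _ _ (yc (k + deg x)%N) x; rewrite leq_addl addnK.
  have := congr1 (fun f : freemod A X => fcoef f x) y0.
  rewrite freemod_sum freemod0 => yx0; rewrite -[RHS]yx0.
  rewrite -(sum_shift z (deg x)) subnKC; last by lia.
  apply: eq_bigr => k _; rewrite /z.
  have := free_compP _ _ (yc k) x; case: ifP => [dk _|_ ->//].
  by rewrite subnK.
Qed.

Lemma free_comp_act n m (a : A) (f : freemod A X) :
  a \in gr n -> f \in free_comp m -> a *: f \in free_comp (n + m)%N.
Proof.
move=> an /free_compP fm; apply/free_compP => x; rewrite freemodZ.
have := fm x; have [dm fx|dm ->] := leqP (deg x) m.
  rewrite (leq_trans dm) ?leq_addl // -addnBA //; exact: (graded_algM hA).
by rewrite mulr0 rpred0; case: ifP.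
Qed.

Definition free_gmod : gmod :=
  @GMod F A gr (freemod A X) (fun n => free_comp n) free_comp_grading free_comp_act.

Lemma free_delta_comp x : freemod_delta A x \in free_comp (deg x).
Proof.
apply/free_compP => y; rewrite freemod_deltaE; case: eqP => [->|_].
  by rewrite leqnn subnn (graded_alg1 hA).
by rewrite rpred0; case: ifP.
Qed.

Lemma free_eval_deg (N : gmod) (phi : X -> N) (p : {linear freemod A X -> N}) :
  (forall f, p f = freemod_eval phi f) -> (forall x, phi x \in gmod_comp N (deg x)) ->
  @hom_degree F A gr 0 free_gmod N p.
Proof.
move=> pE phiN n f /free_compP fn; split=> // _; rewrite subn0 pE.
have [s [us fs]] := freemod_supp f; rewrite (freemod_evalE _ us fs).
apply: rpred_sum => x _; have := fn x.
have [dn fx|_ ->] := leqP (deg x) n; last by rewrite scale0r rpred0.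
by rewrite -[n](subnK dn); exact: gmod_act.
Qed.

End FreeGradedModule.

Section Kernel.
Variables (P N : gmod) (p : {linear P -> N}).
Hypothesis pdeg : hom_degree 0 p.

Definition ker_pred : {pred P} := fun x => p x == 0.

Lemma ker_closed : submod_closed ker_pred.
Proof.
split=> [|a x y /eqP px /eqP py]; rewrite unfold_in /ker_pred ?linear0 //.
by rewrite linearP px py scaler0 addr0.
Qed.

HB.instance Definition _ := GRing.isSubmodClosed.Build A P ker_pred ker_closed.

Definition ker_type : Type := {x : P | x \in ker_pred}.
HB.instance Definition _ := SubChoice.on ker_type.
HB.instance Definition _ := [SubChoice_isSubLmodule of ker_type by <:].

Definition ker_comp n : {pred ker_type} := fun x => val x \in gmod_comp P n.

Lemma ker_comp_zmod n : zmod_closed (ker_comp n).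
Proof.
split=> [|x y xn yn]; rewrite unfold_in /ker_comp ?raddf0 ?raddfB ?rpred0 //.
exact: rpredB.
Qed.

HB.instance Definition _ n :=
  GRing.isZmodClosed.Build ker_type (ker_comp n) (ker_comp_zmod n).

(** A degree-preserving map commutes with [gproj], so the components of a kernel element lie in the
    kernel. *)
Lemma ker_comp_grading : is_grading ker_comp.
Proof.
have PZ := gcomp_zmod P; have NZ := gcomp_zmod N.
have PG := @gmod_sum _ _ _ P; have NG := @gmod_sum _ _ _ N.
have pg k x : x \in gmod_comp P k -> p x \in gmod_comp N k.
  by move=> xk; case: (pdeg xk) => /(_ isT); rewrite subn0.
split=> [x|n y yk y0 k kn].
- have px : p (val x) = 0 by apply/eqP; exact: (valP x).
  have xk k : gproj (fun k => gmod_comp P k) (val x) k \in ker_pred.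
    apply/eqP; apply: etrans (gproj_map PZ PG NZ NG (f := p) (val x) k pg) _.
    exact: etrans (congr1 (fun z => gproj _ z k) px) (gproj0 NZ NG k).
  have [n nE] := gproj_sum PZ PG (val x).
  exists n, (fun k => @exist _ (fun y => y \in ker_pred) _ (xk k) : ker_type).
  split=> [k|]; first by rewrite unfold_in /ker_comp /=; exact: (gproj_mem PZ PG).
  apply: val_inj; rewrite {1}(nE _ (leqnn n)) raddf_sum.
  exact: eq_bigr.
- apply: val_inj; rewrite raddf0.
  apply: (PG.2 n (fun k => val (y k))) => //.
  by rewrite -raddf_sum y0 raddf0.
Qed.

Lemma ker_comp_act n m (a : A) (x : ker_type) :
  a \in gr n -> x \in ker_comp m -> a *: x \in ker_comp (n + m)%N.
Proof. by move=> an xm; rewrite unfold_in /ker_comp linearZ; exact: gmod_act. Qed.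

Definition ker_gmod : gmod :=
  @GMod F A gr ker_type (fun n => ker_comp n) ker_comp_grading ker_comp_act.

(** The arguments about syzygies use the inclusion of the kernel only through these four properties,
    not through the subtype. *)
Lemma ker_val_ex : exists i : {linear ker_gmod -> P},
  [/\ injective i, forall x, p (i x) = 0, forall y, p y = 0 -> exists x, i x = y
    & forall n x, (x \in gmod_comp ker_gmod n) = (i x \in gmod_comp P n)].
Proof.
exists (val : {linear ker_type -> P}); split=> //= [|x|y /eqP py].
- exact: val_inj.
- by apply/eqP; exact: (valP x).
- by exists (@exist _ (fun y => y \in ker_pred) y py).
Qed.

End Kernel.

End GradedCategory.

Section RestrictionOfScalars.
Variables (F : fieldType) (A : algType F) (M : lmodType A).

(** An alias carries the scaling by [F], so that dimensions of components of [A]-modules can be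
    taken while [M] keeps its single scaling by [A]. *)
Definition rs : Type := M.
HB.instance Definition _ := GRing.Zmodule.on rs.
Definition rs_scale (c : F) (x : rs) : rs := (c%:A : A) *: (x : M).

Lemma rs_scaleA a b x : rs_scale a (rs_scale b x) = rs_scale (a * b) x.
Proof. by rewrite /rs_scale scalerA -scalerAl mul1r scalerA. Qed.
Lemma rs_scale1 : left_id 1 rs_scale.
Proof. by move=> x; rewrite /rs_scale !scale1r. Qed.
Lemma rs_scaleDr : right_distributive rs_scale +%R.
Proof. by move=> a x y; rewrite /rs_scale scalerDr. Qed.
Lemma rs_scaleDl x : {morph rs_scale^~ x : a b / a + b}.
Proof. by move=> a b; rewrite /rs_scale !scalerDl. Qed.

HB.instance Definition _ := GRing.Zmodule_isLmodule.Build F rs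
  rs_scaleA rs_scale1 rs_scaleDr rs_scaleDl.

Lemma rsE (c : F) (x : rs) : c *: x = (c%:A : A) *: (x : M) :> M.
Proof. by []. Qed.

End RestrictionOfScalars.

Lemma rs_linear (F : fieldType) (A : algType F) (M N : lmodType A) (p : {linear M -> N}) :
  exists q : {linear rs M -> rs N}, forall x, q x = p x.
Proof.
apply: linear_ex => a x y.
by rewrite !rsE linearP.
Qed.

Section Covers.
Variables (F : fieldType) (A : algType F) (gr : nat -> submodClosed A).
Hypothesis hA : graded_alg gr.

Local Notation gmod := (gmod gr).

Definition rcomp (N : gmod) n : {pred rs N} := fun x => (x : N) \in gmod_comp N n.
Arguments rcomp : clear implicits.

Lemma rcomp_linear (N : gmod) n (c : F) (x y : rs N) :
  x \in rcomp N n -> y \in rcomp N n -> c *: x + y \in rcomp N n.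
Proof.
move=> xn yn; rewrite unfold_in /rcomp rsE; apply: rpredD => //.
by rewrite -[n]add0n; apply: gmod_act => //; apply: rpredZ; exact: (graded_alg1 hA).
Qed.

(** For the s-th syzygies and [k = s] this is linearity of the resolution. Finite dimension in
    degree [k] lets a cover have finitely many generators. *)
Definition generated_in (k : nat) (N : gmod) : Prop :=
  [/\ forall n x, (n < k)%N -> x \in gmod_comp N n -> x = 0,
      exists m, has_dim (rcomp N k) m
    & forall W : submodClosed N, (forall x, x \in gmod_comp N k -> x \in W) ->
        forall x, x \in W].

Definition free_on (k : nat) (P : gmod) m (b : 'I_m -> P) : Prop :=
  [/\ forall i, b i \in gmod_comp P k,
      forall n x, (n < k)%N -> x \in gmod_comp P n -> x = 0,
      forall n x, (k <= n)%N -> x \in gmod_comp P n ->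
        exists2 a : 'I_m -> A, forall i, a i \in gr (n - k)%N & x = \sum_i a i *: b i
    & forall a : 'I_m -> A, \sum_i a i *: b i = 0 -> forall i, a i = 0].

Definition image_pred (P N : lmodType A) (p : {linear P -> N}) : {pred N} :=
  fun y => `[< exists x, p x = y >].

Lemma image_closed (P N : lmodType A) (p : {linear P -> N}) : submod_closed (image_pred p).
Proof.
split=> [|a _ _ /asboolP[x <-] /asboolP[y <-]]; apply/asboolP.
  by exists 0; rewrite linear0.
by exists (a *: x + y); rewrite linearP.
Qed.

HB.instance Definition _ (P N : lmodType A) (p : {linear P -> N}) :=
  GRing.isSubmodClosed.Build A N (image_pred p) (image_closed p).

(** The last clause is conditional so that every module has a cover: the resolution can then be
    defined by plain recursion and its linearity proved afterwards. Mapping the free generators to a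
    basis of degree [k] is minimality. *)
Definition is_cover (k : nat) (N P : gmod) (p : {linear P -> N}) : Prop :=
  [/\ projective P, hom_degree 0 p, forall y, exists x, p x = y
    & generated_in k N -> exists m (b : 'I_m -> P),
        free_on k b /\ is_basis (rcomp N k) (fun i => p (b i) : rs N)].

Lemma ord_enum_supp m (f : freemod A 'I_m) x : x \notin enum 'I_m -> fcoef f x = 0.
Proof. by rewrite mem_enum. Qed.

Lemma cover_ex (k : nat) (N : gmod) : exists (P : gmod) (p : {linear P -> N}), is_cover k p.
Proof.
have [Nk|nNk] := pselect (generated_in k N).
- have [N0 [m [v vB]] Ngen] := Nk; have [vN vI vG] := vB.
  (* The free generators lift a basis of degree [k]; the image is a submodule containing that
     degree, hence it is everything. *)
  pose P : gmod := free_gmod hA (fun _ : 'I_m => k).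
  have [p pE] := linear_ex (freemod_eval_linear (v : 'I_m -> N)).
  have pb i : p (freemod_delta A i) = v i by rewrite pE freemod_eval_delta.
  exists P, p; split.
  + exact: freemod_projective.
  + exact: free_eval_deg pE vN.
  + move=> y; apply/(asboolP (exists x, p x = y)).
    change (y \in image_pred p); apply: (Ngen (image_pred p)) => x /vG[c ->].
    apply: rpred_sum => i _; rewrite rsE; apply: rpredZ; apply/asboolP.
    by exists (freemod_delta A i).
  + move=> _; exists m, (fun i => freemod_delta A i); split; last first.
      by have -> : (fun i => p (freemod_delta A i) : rs N) = v by apply/funext.
    have dE (x : freemod A 'I_m) : x = \sum_i fcoef x i *: freemod_delta A i.
      rewrite {1}[x]freemod_decomp (freemod_evalE _ (enum_uniq _) (@ord_enum_supp _ _)).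
      by rewrite big_enum.
    split.
    * by move=> i; exact: free_delta_comp hA _ _ i.
    * move=> n x nk /free_compP xn; apply: freemod_ext => i; rewrite freemod0.
      by have := xn i; rewrite leqNgt nk.
    * move=> n x kn /free_compP xn; exists (fcoef x); last exact: dE.
      by move=> i; have := xn i; rewrite kn.
    * move=> a /(congr1 (fun f : freemod A 'I_m => fcoef f)) a0 i.
      have := congr1 (fun f => f i) a0; rewrite /= freemod_sum freemod0 => <-.
      rewrite (bigD1 i) //= freemodZ freemod_deltaE eqxx mulr1 big1 ?addr0 // => j ji.
      by rewrite freemodZ freemod_deltaE eq_sym (negbTE ji) mulr0.
- have NZ := gcomp_zmod N; have NG := @gmod_sum _ _ _ N.
  (* The generator (j, x) stands for the degree-j component of x. *)
  pose phi (x : nat * N) := gproj (fun k => gmod_comp N k) x.2 x.1.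
  pose P : gmod := free_gmod hA (fun x : nat * N => x.1).
  have [p pE] := linear_ex (freemod_eval_linear phi).
  exists P, p; split=> //.
  + exact: freemod_projective.
  + apply: free_eval_deg pE _ => x; exact: gproj_mem.
  + move=> y; have [n yE] := gproj_sum NZ NG y.
    exists (\sum_(j < n) freemod_delta A ((j : nat), y)); rewrite linear_sum [RHS](yE n) //.
    by apply: eq_bigr => j _; rewrite pE freemod_eval_delta.
Qed.

Lemma free_on_dim k (P : gmod) m (b : 'I_m -> P) n u :
  free_on k b -> (k <= n)%N -> has_dim (gr (n - k)%N) u ->
  has_dim (rcomp P n) (m * u).
Proof.
move=> [bP _ bG bI] kn [e [eA eI eG]].
have -> : (m * u = #|{: 'I_m * 'I_u}|)%N by rewrite card_prod !card_ord.
pose v (ij : 'I_m * 'I_u) : rs P := e ij.2 *: b ij.1.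
have sumE (c : 'I_m * 'I_u -> F) :
  \sum_ij c ij *: v ij = \sum_i (\sum_j c (i, j) *: e j) *: b i :> P.
  rewrite (eq_bigr (fun ij => c (ij.1, ij.2) *: v (ij.1, ij.2))); last by case.
  rewrite -(pair_big xpredT xpredT (fun i j => c (i, j) *: v (i, j))) /=.
  apply: eq_bigr => i _; rewrite scaler_suml; apply: eq_bigr => j _.
  by rewrite rsE /v /= scalerA -scalerAl mul1r.
apply: (@has_dimP _ _ _ _ v); split.
- move=> [i j]; rewrite unfold_in /rcomp /v /= -[n](subnK kn).
  exact: gmod_act.
- move=> c; rewrite [X in X = _ -> _]sumE => /bI c0 [i j].
  exact: (eI (fun j => c (i, j)) (c0 i)).
- move=> x /(bG _ _ kn)[a aA ->].
  have /choice[c cE] : forall i, lincomb e (a i) by move=> i; exact/eG/aA.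
  exists (fun ij => c ij.1 ij.2); rewrite [RHS]sumE /=.
  by apply: eq_bigr => i _; rewrite cE.
Qed.

End Covers.
Arguments rcomp {F A gr} N n.

(** * The minimal resolution of the trivial module *)

Section TrivialModule.
Variables (F : fieldType) (A : algType F).

(** Making [eps] part of the type attaches the action of [A] through this augmentation to a copy of
    [F]. *)
Definition triv_module (eps : {lrmorphism A -> F^o}) : Type := F.

Variable eps : {lrmorphism A -> F^o}.
Local Notation ktriv := (triv_module eps).

HB.instance Definition _ := GRing.Zmodule.copy ktriv F.
Definition ktriv_scale (a : A) (x : ktriv) : ktriv := (eps a : F) * x.

Lemma ktriv_scaleA a b x : ktriv_scale a (ktriv_scale b x) = ktriv_scale (a * b) x.
Proof. by rewrite /ktriv_scale rmorphM mulrA. Qed.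
Lemma ktriv_scale1 : left_id 1 ktriv_scale.
Proof. by move=> x; rewrite /ktriv_scale rmorph1 mul1r. Qed.
Lemma ktriv_scaleDr : right_distributive ktriv_scale +%R.
Proof. by move=> a x y; exact: mulrDr. Qed.
Lemma ktriv_scaleDl x : {morph ktriv_scale^~ x : a b / a + b}.
Proof. by move=> a b; rewrite /ktriv_scale raddfD mulrDl. Qed.

HB.instance Definition _ := GRing.Zmodule_isLmodule.Build A ktriv
  ktriv_scaleA ktriv_scale1 ktriv_scaleDr ktriv_scaleDl.

Definition ktriv_comp (n : nat) : {pred ktriv} := fun x => (n == 0%N) || (x == 0).

Lemma ktriv_comp_zmod n : zmod_closed (ktriv_comp n).
Proof.
split=> [|x y]; rewrite /ktriv_comp !unfold_in; first by rewrite eqxx orbT.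
by case: eqP => //= _ /eqP -> /eqP ->; rewrite subrr.
Qed.

HB.instance Definition _ n :=
  GRing.isZmodClosed.Build ktriv (ktriv_comp n) (ktriv_comp_zmod n).

Lemma ktriv_grading : is_grading ktriv_comp.
Proof.
split=> [x|n y yk y0 k kn].
  exists 1%N, (fun k => if k == 0%N then x else 0); split=> [k|]; last by rewrite big_ord1.
  by rewrite unfold_in /ktriv_comp; case: (k == 0%N); rewrite ?eqxx.
have yS j : y j.+1 = 0 by apply/eqP; have := yk j.+1.
case: k kn => [|k] kn; last exact: yS.
by case: n y0 kn => [//|n]; rewrite big_ord_recl big1 ?addr0 // => j _; exact: yS.
Qed.

Variable gr : nat -> submodClosed A.
Hypothesis eps_gr : forall k x, x \in gr k.+1 -> eps x = 0.

Lemma ktriv_act n m (a : A) (x : ktriv) :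
  a \in gr n -> x \in ktriv_comp m -> a *: x \in ktriv_comp (n + m)%N.
Proof.
move=> an; rewrite !unfold_in /ktriv_comp addn_eq0; case: n an => [|n] an /=.
  by case: (m == 0%N) => //= /eqP ->; rewrite scaler0.
by move=> _; apply/eqP; rewrite -[LHS]/((eps a : F) * x) (eps_gr an) mul0r.
Qed.

Definition ktriv_gmod : gmod gr :=
  @GMod F A gr ktriv (fun n => ktriv_comp n) ktriv_grading ktriv_act.

Hypothesis hA : graded_alg gr.
Hypothesis gr0E : forall x, x \in gr 0%N -> x = (eps x : F)%:A.

Lemma ktriv_trivial : is_trivial_gmod ktriv_gmod.
Proof.
split; last by [].
have ql : linear (fun a : A^o => eps a : ktriv).
  by move=> a x y; rewrite raddfD /= rmorphM.
have [q qE] := linear_ex ql; exists q; split=> [y|a]; rewrite ?qE.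
  by exists (y%:A); rewrite qE linearZ /= rmorph1 [_ *: _]mulr1.
have grZ k : zmod_closed (gr k) by exact: submod_zmod_closed.
have grG := graded_alg_sum hA.
split=> [a0|[n [y [yk ->]]]]; last first.
  by rewrite raddf_sum big1 // => k _; exact: eps_gr (yk k).
pose y := gproj (fun k => gr k) a.
have yk k : y k \in gr k by exact: (gproj_mem grZ grG).
have [n nE] := gproj_sum grZ grG a.
exists n, (fun k => y k.+1); split=> [//|].
have aE : a = y 0%N + \sum_(k < n) y k.+1.
  by rewrite {1}(nE n.+1 (leqnSn n)) big_ord_recl.
suff y0 : y 0%N = 0 by rewrite {1}aE y0 add0r.
rewrite (gr0E (yk 0%N)).
have -> : eps (y 0%N) = 0; last by rewrite scale0r.
move: a0; rewrite {1}aE raddfD raddf_sum big1 /= => [|k _]; last exact: eps_gr (yk _).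
by rewrite addr0.
Qed.

Lemma ktriv_dim n : has_dim (rcomp ktriv_gmod n) (n == 0%N).
Proof.
case: n => [|n]; last by apply: has_dim0 => x /eqP.
exists (fun=> (1 : F) : rs ktriv); split=> // [c|x _].
  rewrite big_ord1 rsE => c0 i; rewrite ord1.
  by move: c0; rewrite -[LHS]/((eps _ : F) * 1) mulr1 linearZ /= rmorph1 [_ *: _]mulr1.
exists (fun=> (x : F)); rewrite big_ord1 rsE.
by rewrite -[RHS]/((eps _ : F) * 1) mulr1 linearZ /= rmorph1 [_ *: _]mulr1.
Qed.

Lemma ktriv_generated : generated_in 0 ktriv_gmod.
Proof.
by split=> // [|W W0 x]; [exists 1%N; exact: (ktriv_dim 0) | exact: W0].
Qed.

End TrivialModule.

(** Extend a basis of [T] together with [z] to a basis of [S], and read off the coordinate at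
    [z]. *)
Lemma separating_functional (F : fieldType) (V : lmodType F) (S T : {pred V}) n z :
  has_dim S n -> {subset T <= S} ->
  (forall k x y, x \in S -> y \in S -> k *: x + y \in S) ->
  0 \in T -> (forall k x y, x \in T -> y \in T -> k *: x + y \in T) ->
  z \in S -> z \notin T ->
  exists phi : V -> F,
    [/\ forall k x y, x \in S -> y \in S -> phi (k *: x + y) = k * phi x + phi y,
        forall x, x \in T -> phi x = 0 & phi z = 1].
Proof.
move=> Sn TS Slin T0 Tlin zS zT; have [m [v [vT vI vG]] _] := has_dim_sub TS Sn.
have nz : ~ lincomb v z.
  move=> [c zE]; case/negP: zT; rewrite zE; elim/big_rec: _ => // i y _ yT.
  exact: Tlin (vT i) yT.
pose v' (i : 'I_m + unit) := match i with inl i => v i | inr _ => z end.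
have v'I : indep v' by exact: indep_extend1.
have v'S i : v' i \in S by case: i => //= i; exact/TS/vT.
have [J [w [h [hI hw wB]]]] : exists (J : finType) (w : J -> V) (h : _ -> J),
    [/\ injective h, forall i, w (h i) = v' i & is_basis S w].
  by apply: (@basis_extend _ _ _ n) => // J w wS wI; exact: indep_le_dim Sn wS wI.
have [c [cE cU]] := basis_coord wB.
exists (fun x => c x (h (inr tt))); split.
- move=> k x y xS yS; rewrite -(cU (fun j => k * c x j + c y j)); congr (c _ _).
  rewrite {1}(cE x xS) {1}(cE y yS) scaler_sumr -big_split.
  by apply: eq_bigr => j _; rewrite scalerDl scalerA.
- move=> x /vG[b ->].
  pose b' j := \sum_(i | h (inl i) == j) b i.
  have -> : \sum_i b i *: v i = \sum_j b' j *: w j.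
    rewrite (partition_big (h \o inl) xpredT) //=; apply: eq_bigr => j _.
    by rewrite scaler_suml; apply: eq_bigr => i /eqP <-; rewrite hw.
  by rewrite cU /b' big_pred0 // => i; apply/eqP => /hI.
- have <- : c (\sum_j (j == h (inr tt))%:R *: w j) (h (inr tt)) = 1 by rewrite cU eqxx.
  rewrite -[z]/(v' (inr tt)) -hw; congr (c _ _).
  rewrite (bigD1 (h (inr tt))) //= eqxx scale1r big1 ?addr0 // => j /negbTE->.
  by rewrite scale0r.
Qed.

Section Resolution.
Variables (F : fieldType) (A : algType F) (gr : nat -> submodClosed A).
Hypothesis hA : graded_alg gr.
Local Notation gmod := (gmod gr).

Let grZ k : zmod_closed (gr k). Proof. exact: submod_zmod_closed. Qed.
Let grG : is_grading (fun k => gr k). Proof. exact: graded_alg_sum hA. Qed.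

Lemma gproj_act (N : gmod) j (a : A) (x : N) t : a \in gr j ->
  gproj (fun k => gmod_comp N k) (a *: x) t =
  if (j <= t)%N then a *: gproj (fun k => gmod_comp N k) x (t - j)%N else 0.
Proof.
have NZ := gcomp_zmod N; have NG := @gmod_sum _ _ _ N.
move=> aj; move: t; apply: (homog_decomp_uniq NZ NG (gprojP NZ NG _)).
have [xg [n [x0 xE]]] := gprojP NZ NG x; split=> [t|].
  case: ifP => [jt|_]; last exact: rpred0.
  by rewrite -{2}[t](subnKC jt); exact: gmod_act.
exists (j + n)%N; split=> [t jnt|].
  by case: ifP => // jt; rewrite x0 ?scaler0 //; lia.
rewrite (sum_shift (fun k => a *: gproj (fun k => gmod_comp N k) x k)).
by rewrite -scaler_sumr -xE.
Qed.

Lemma cover_sig (k : nat) (N : gmod) : {P : gmod & {p : {linear P -> N} | is_cover k p}}.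
Proof. by have [P /cid] := cid (cover_ex hA k N); exists P. Qed.

Definition cov k N : gmod := projT1 (cover_sig k N).
Definition covp k N : {linear cov k N -> N} := sval (projT2 (cover_sig k N)).
Lemma covP k N : is_cover k (covp k N). Proof. exact: svalP (projT2 (cover_sig k N)). Qed.
Lemma cov_deg k N : hom_degree 0 (covp k N). Proof. by case: (covP k N). Qed.
Lemma cov_surj k N y : exists x, covp k N x = y. Proof.
  by case: (covP k N) => _ _ /(_ y). Qed.

Variable K : gmod.

(** The syzygy modules of [K]. Stage [s] is covered with target degree [s], in anticipation of
    linearity. *)
Fixpoint syz (s : nat) : gmod :=
  match s with
  | 0 => K
  | s'.+1 => ker_gmod (@cov_deg s' (syz s'))
  end.

Lemma syz_incl_sig s : {i : {linear syz s.+1 -> cov s (syz s)} |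
  [/\ injective i, forall x, covp s (syz s) (i x) = 0,
      forall y, covp s (syz s) y = 0 -> exists x, i x = y
    & forall n x, (x \in gmod_comp (syz s.+1) n) = (i x \in gmod_comp (cov s (syz s)) n)]}.
Proof. exact: cid (ker_val_ex (@cov_deg s (syz s))). Qed.

Definition syz_incl s := sval (syz_incl_sig s).

Lemma syz_incl_inj s : injective (syz_incl s). Proof. by case: (svalP (syz_incl_sig s)). Qed.
Lemma covp_syz_incl s x : covp s (syz s) (syz_incl s x) = 0.
Proof. by case: (svalP (syz_incl_sig s)) => _ /(_ x). Qed.
Lemma syz_incl_ker s y : covp s (syz s) y = 0 -> exists x, syz_incl s x = y.
Proof. by case: (svalP (syz_incl_sig s)) => _ _ /(_ y). Qed.
Lemma syz_incl_comp s n x :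
  (x \in gmod_comp (syz s.+1) n) = (syz_incl s x \in gmod_comp (cov s (syz s)) n).
Proof. by case: (svalP (syz_incl_sig s)) => _ _ _ /(_ n x). Qed.

Definition syz_d s : {linear cov s.+1 (syz s.+1) -> cov s (syz s)} :=
  syz_incl s \o covp s.+1 (syz s.+1).

Lemma syz_dE s x : syz_d s x = syz_incl s (covp s.+1 (syz s.+1) x). Proof. by []. Qed.

Lemma syz_d_eq0 s x : syz_d s x = 0 <-> exists y, x = syz_d s.+1 y.
Proof.
split=> [|[y ->]]; rewrite syz_dE; last by rewrite syz_dE covp_syz_incl linear0.
move=> dx; have /syz_incl_ker[y yE] : covp s.+1 (syz s.+1) x = 0.
  by apply: (@syz_incl_inj s); rewrite dx linear0.
by have [z zE] := cov_surj s.+2 y; exists z; rewrite syz_dE zE yE.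
Qed.

Lemma syz_d_deg s : hom_degree 0 (syz_d s).
Proof.
move=> n x xn; split=> // _; rewrite syz_dE -syz_incl_comp.
by have [/(_ isT)] := cov_deg xn.
Qed.

Lemma syz_exact0 x : covp 0 (syz 0) x = 0 <-> exists y, x = syz_d 0 y.
Proof.
split=> [/syz_incl_ker[y yE]|[y ->]]; last by rewrite syz_dE covp_syz_incl.
by have [z zE] := cov_surj 1 y; exists z; rewrite syz_dE zE yE.
Qed.

Definition syz_resolution : proj_resolution K :=
  @ProjResolution F A gr K (fun s => cov s (syz s)) syz_d (covp 0 (syz 0))
    (fun s => let: And4 h _ _ _ := covP s (syz s) in h)
    syz_d_deg (@cov_deg 0 (syz 0)) (@cov_surj 0 (syz 0)) syz_exact0 syz_d_eq0.

End Resolution.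

(** * Linearity of the resolution from the vanishing of off-diagonal Ext *)

Section DiagonalResolution.
Variables (F : fieldType) (A : algType F) (gr : nat -> submodClosed A).
Variable (eps : {lrmorphism A -> F^o}) (u : nat -> nat).
Hypothesis hA : graded_alg gr.
Hypothesis eps_gr : forall k x, x \in gr k.+1 -> eps x = 0.
Hypothesis gr0E : forall x, x \in gr 0%N -> x = (eps x : F)%:A.
Hypothesis gr_dim : forall n, has_dim (gr n) (u n).

Let K := ktriv_gmod eps_gr.
Hypothesis hExt : forall s t : nat, s <> t -> Ext_vanishes s t K K.

Let grZ k : zmod_closed (gr k). Proof. exact: submod_zmod_closed. Qed.
Let grG : is_grading (fun k => gr k). Proof. exact: graded_alg_sum hA. Qed.

Local Notation N := (syz hA K).
Local Notation P s := (cov hA s (N s)).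
Local Notation p s := (covp hA s (N s)).

Lemma eps_gproj0 a : eps a = eps (gproj (fun k => gr k) a 0).
Proof.
have [n nE] := gproj_sum grZ grG a.
rewrite {1}(nE n.+1 (leqnSn n)) big_ord_recl raddfD raddf_sum big1 /= ?addr0 // => k _.
exact: (eps_gr (gproj_mem grZ grG a _)).
Qed.

(* phi extended by zero is A-linear, because A_+ M meets degree t inside W. *)
Lemma functional_extend (M : gmod gr) (t : nat) (phi : rs M -> F) (W : submodClosed M) :
  (forall k x y, x \in rcomp M t -> y \in rcomp M t ->
    phi (k *: x + y) = k * phi x + phi y) ->
  (forall x, x \in rcomp M t -> x \in W -> phi x = 0) ->
  (forall n x, (n < t)%N -> x \in gmod_comp M n -> x \in W) ->
  exists2 f : {linear M -> K}, hom_degree t f &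
    forall x, x \in gmod_comp M t -> f x = phi x.
Proof.
move=> phiL phiW lowW.
have MZ := gcomp_zmod M; have MG := @gmod_sum _ _ _ M.
pose pr x : rs M := gproj (fun k => gmod_comp M k) x t.
have prM x : pr x \in rcomp M t by exact: (gproj_mem MZ MG).
have prD x y : pr (x + y) = pr x + pr y by exact: (gprojD MZ MG).
have phiD x y : x \in rcomp M t -> y \in rcomp M t -> phi (x + y) = phi x + phi y.
  by move=> xM yM; rewrite -[x]scale1r phiL // mul1r scale1r.
have M0 : (0 : rs M) \in rcomp M t by exact: (rpred0 (gmod_comp M t)).
have phi0 : phi 0 = 0 by apply: phiW => //; exact: (rpred0 W).
have phiZ k x : x \in rcomp M t -> phi (k *: x) = k * phi x.
  by move=> xM; rewrite -[k *: x]addr0 phiL // phi0 addr0.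
have fl : linear (fun x => phi (pr x) : triv_module eps).
  move=> a x y; rewrite prD phiD //; congr (_ + _).
  rewrite -[RHS]/((eps a : F) * phi (pr x)) eps_gproj0.
  have [n nE] := gproj_sum grZ grG a.
  rewrite {1}(nE n.+1 (leqnSn n)) scaler_suml.
  have pr_sum (I : Type) (r : seq I) (g : I -> M) :
      phi (pr (\sum_(i <- r) g i)) = \sum_(i <- r) phi (pr (g i)).
    elim: r => [|i r IH]; last by rewrite !big_cons prD phiD // IH.
    by rewrite !big_nil /pr (gproj0 MZ MG) phi0.
  rewrite pr_sum big_ord_recl big1 ?addr0 => [|j _].
    rewrite /pr (gproj_act _ _ (gproj_mem grZ grG a 0)) leq0n subn0.
    rewrite {1}(gr0E (gproj_mem grZ grG a 0)) -rsE phiZ //; exact: prM.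
  have aj := gproj_mem grZ grG a (lift ord0 j).
  apply: phiW => //; rewrite /pr (gproj_act _ _ aj).
  case: ifP => jt; last exact: rpred0.
  apply: rpredZ; apply: (lowW (t - lift ord0 j)%N); last exact: (gproj_mem MZ MG).
  by move: jt; rewrite lift0; lia.
have [f fE] := linear_ex fl; exists f => [i x xi|x xt];
  last by rewrite fE /pr (gproj_id MZ MG _ xt) eqxx.
rewrite fE /pr (gproj_id MZ MG _ xi); split=> ti.
  rewrite unfold_in /= /ktriv_comp; case: (eqVneq t i) => [->|_]; first by rewrite subnn.
  by rewrite phi0 eqxx orbT.
by rewrite gtn_eqF // phi0.
Qed.

Lemma syz_dim_free s t m (b : 'I_m -> P s) : free_on s b -> (s <= t)%N ->
  exists n, has_dim (rcomp (N s.+1) t) n.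
Proof.
move=> bF st; have [inc incE] := rs_linear (syz_incl hA K s).
have Pt := free_on_dim bF st (gr_dim (t - s)).
have [|x xt|n Nt _] := has_dim_inj (f := inc) (S1 := rcomp (N s.+1) t) _ _ Pt.
- by move=> x y; rewrite !incE; exact: syz_incl_inj.
- by rewrite unfold_in /rcomp incE -syz_incl_comp.
- by exists n.
Qed.

(* A first degree t > s + 1 in which N (s + 1) needs a new generator would give
   a nonzero class in Ext^{s + 1, t}. *)
Lemma generated_in_step s : generated_in s (N s) -> generated_in s.+1 (N s.+1).
Proof.
move=> Ns; have [_ _ _ /(_ Ns)[m [b [bF [pbN pbI pbG]]]]] := covP hA s (N s).
have [bP P0 bG bI] := bF; have [N0 _ _] := Ns.
(* Minimality: coefficients of an element of degree [s] are scalars and the images of the generators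
   are independent, so the kernel of the cover starts in degree [s + 1]. *)
have low n x : (n < s.+1)%N -> x \in gmod_comp (N s.+1) n -> x = 0.
  rewrite ltnS leq_eqVlt syz_incl_comp => /orP[/eqP->|ns] xn;
    apply: (@syz_incl_inj _ _ _ hA K s); last first.
    by rewrite linear0; exact: P0 ns xn.
  have [a a0 xE] := bG _ _ (leqnn s) xn; rewrite subnn in a0.
  have := covp_syz_incl x; rewrite xE linear_sum linear0.
  have aE i : a i = (eps (a i) : F)%:A by exact: gr0E.
  move=> px0; rewrite big1 // => i _; rewrite aE.
  have := pbI (fun i => eps (a i) : F); rewrite -[X in _ = X -> _]px0.
  move=> -> //; first by rewrite !scale0r.
  by apply: eq_bigr => j _; rewrite rsE -aE linearZ.
have dimN t : exists n, has_dim (rcomp (N s.+1) t) n.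
  have [ts|st] := ltnP t s.+1; last exact: syz_dim_free bF (ltnW st).
  by exists 0%N; apply: has_dim0 => x; exact: low.
split=> // W W0.
suff Wt t x : x \in gmod_comp (N s.+1) t -> x \in W.
  move=> x; have NZ := gcomp_zmod (N s.+1); have NG := @gmod_sum _ _ _ (N s.+1).
  have [n xE] := gproj_sum NZ NG x.
  rewrite (xE n) //; apply: rpred_sum => k _; apply: (Wt k); exact: (gproj_mem NZ NG).
elim/ltn_ind: t x => t IH z zt; apply: contrapT => /negP zW.
have [ts|st] := ltnP t s.+1; first by rewrite (low t z) ?rpred0 in zW.
move: st; rewrite leq_eqVlt => /orP[/eqP st|st]; first by rewrite W0 // in zW;
  rewrite -st in zt.
have [n Nt] := dimN t.
pose T : {pred rs (N s.+1)} := fun x => (x \in rcomp (N s.+1) t) && ((x : N s.+1) \in W).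
have [||||||phi [phiL phi0 phi1]] := separating_functional (T := T) (z := z) Nt.
- by move=> x /andP[].
- by move=> k x y xt yt; exact: rcomp_linear.
- by rewrite unfold_in /T unfold_in /rcomp !rpred0.
- move=> k x y /andP[xt xW] /andP[yt yW]; rewrite unfold_in /T rcomp_linear //=.
  by apply: rpredD yW; exact: rpredZ.
- by [].
- by rewrite unfold_in /T negb_and zW orbT.
have [|n' x n't|f fdeg fE] := functional_extend phiL (W := W).
- by move=> x xt xW; apply: phi0; rewrite unfold_in /T xt.
- exact: IH.
have := hExt (s := s.+1) (t := t) _ (P := syz_resolution hA K) (f := f \o p s.+1).
have neq : s.+1 <> t by move=> st'; rewrite st' ltnn in st.
move=> /(_ neq) [].
- move=> i x xi; apply: fdeg; have [/(_ isT)] := cov_deg xi.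
  by rewrite subn0.
- by move=> x; rewrite /= covp_syz_incl linear0.
(* The cocycle [f \o p s.+1] is the coboundary of [g]. As [g] lowers degrees by [t > s], it kills
   the generators and hence all homogeneous elements of [P s]; at a preimage of [z] this contradicts
   [phi z = 1]. *)
move=> g [gdeg gE].
have g0 i : g (b i) = 0 by have [_] := gdeg _ _ (bP i); apply; exact: ltnW st.
have gP k x : x \in gmod_comp (P s) k -> g x = 0.
  have [ks|sk] := ltnP k s; first by move=> /(P0 _ _ ks)->; rewrite linear0.
  move=> /(bG _ _ sk)[a _ ->]; rewrite linear_sum big1 // => i _.
  by rewrite linearZ /= g0 scaler0.
have [y yz] := cov_surj hA s.+1 z.
have dy : res_d (syz_resolution hA K) s y = syz_incl hA K s z by rewrite -yz.
have := gE y; rewrite dy /= yz fE // phi1 (gP t) -?syz_incl_comp //.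
by move/eqP; rewrite oner_eq0.
Qed.

Lemma syz_generated s : generated_in s (N s).
Proof. by elim: s => [|s]; [exact: ktriv_generated | exact: generated_in_step]. Qed.

Lemma syz_free_basis s : {m & {b : 'I_m -> P s |
  free_on s b /\ is_basis (rcomp (N s) s) (fun i => p s (b i) : rs (N s))}}.
Proof.
have [_ _ _ /(_ (syz_generated s)) /cid[m /cid bP]] := covP hA s (N s).
by exists m.
Qed.

Definition syz_rank s := projT1 (syz_free_basis s).
Definition syz_gen s : 'I_(syz_rank s) -> P s := sval (projT2 (syz_free_basis s)).

Lemma syz_gen_free s : free_on s (@syz_gen s).
Proof. by have [] := svalP (projT2 (syz_free_basis s)). Qed.

Lemma syz_gen_basis s :
  is_basis (rcomp (N s) s) (fun i => p s (@syz_gen s i) : rs (N s)).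
Proof. by have [] := svalP (projT2 (syz_free_basis s)). Qed.

Lemma syz_dim s t : exists n, has_dim (rcomp (N s) t) n.
Proof.
case: s => [|s]; first by exists (t == 0)%N; exact: ktriv_dim.
have [st|ts] := leqP s t; first exact: syz_dim_free (@syz_gen_free s) st.
have [N0 _ _] := syz_generated s.+1.
by exists 0%N; apply: has_dim0 => x; apply: N0; exact: ltnW.
Qed.

(** Degree [t] of the short exact sequence from [N s.+1] through [P s] to [N s]. *)
Lemma syz_dim_exact s t a c : (s <= t)%N ->
  has_dim (rcomp (N s.+1) t) a -> has_dim (rcomp (N s) t) c ->
  (a + c = syz_rank s * u (t - s))%N.
Proof.
move=> st Na Nc; have [inc incE] := rs_linear (syz_incl hA K s).
have [q qE] := rs_linear (p s).
have pdeg x : x \in gmod_comp (P s) t -> p s x \in gmod_comp (N s) t.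
  by move=> xt; have [/(_ isT)] := cov_deg xt; rewrite subn0.
apply: (has_dim_uniq (S := rcomp (P s) t)); last first.
  exact: free_on_dim (@syz_gen_free s) st (gr_dim _).
apply: (@has_dim_exact _ _ _ _ inc q (rcomp (N s.+1) t) _ (rcomp (N s) t)) => //.
- by move=> x y; rewrite !incE; exact: syz_incl_inj.
- by move=> k x y; exact: rcomp_linear.
- move=> x; rewrite qE; split=> [[xt px]|[y yt ->]].
    have [y yE] := syz_incl_ker px; exists y; last by rewrite incE yE.
    by rewrite unfold_in /rcomp syz_incl_comp yE.
  rewrite incE covp_syz_incl; split=> //.
  by rewrite unfold_in /rcomp -syz_incl_comp.
- by move=> x xt; rewrite qE; exact: pdeg.
- move=> z zt; have [x xz] := cov_surj hA s z.
  have PZ := gcomp_zmod (P s); have PG := @gmod_sum _ _ _ (P s).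
  have NZ := gcomp_zmod (N s); have NG := @gmod_sum _ _ _ (N s).
  exists (gproj (fun k => gmod_comp (P s) k) x t); first exact: (gproj_mem PZ PG).
  rewrite qE; apply: etrans (gproj_map PZ PG NZ NG (f := p s) x t _) _.
    by move=> k y yk; have [/(_ isT)] := cov_deg yk; rewrite subn0.
  apply: etrans (congr1 (fun y => gproj _ y t) xz) _.
  by rewrite (gproj_id NZ NG _ zt) eqxx.
Qed.

(** Degree [n] of q(t) times the Hilbert series of [A]. The relations of [syz_dim_exact] telescope,
    and the remainder vanishes because [N n.+1] starts in degree [n + 1]. *)
Lemma koszul_euler n :
  \sum_(s < n.+1) (-1) ^+ s * (syz_rank s * u (n - s))%:R = (n == 0%N)%:R :> int.
Proof.
have /choice[a aP] : forall s, exists f, forall t, has_dim (rcomp (N s) t) (f t).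
  by move=> s; have /choice[f fP] := syz_dim s; exists f.
have a0 : a 0%N n = (n == 0%N) by exact: has_dim_uniq (aP 0%N n) (ktriv_dim _ _).
have aS : a n.+1 n = 0%N.
  apply: has_dim_uniq (aP _ _) _; apply: has_dim0 => x.
  by have [N0 _ _] := syz_generated n.+1; exact: N0.
suff main k : (k <= n.+1)%N -> \sum_(s < k) (-1) ^+ s * (syz_rank s * u (n - s))%:R
    = (a 0%N n)%:R - (-1) ^+ k * (a k n)%:R :> int.
  by rewrite main // aS mulr0 subr0 a0.
elim: k => [|k IH] kn; first by rewrite big_ord0 expr0 mul1r subrr.
rewrite big_ord_recr /= IH 1?ltnW // -(@syz_dim_exact k n (a k.+1 n) (a k n)) //.
by rewrite natrD exprS; ring.
Qed.

Section Matrices.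
Variables (d : nat) (e : 'I_d -> A).
Hypothesis eB : is_basis (gr 1%N) e.

(** By linearity the differential has entries in degree one of [A]; [T k] collects their coordinates
    along [e k]. *)
Lemma syz_matrix_ex s : exists T : 'I_d -> 'M[F]_(syz_rank s.+1, syz_rank s),
  forall i, syz_d hA K s (@syz_gen s.+1 i)
    = \sum_j (\sum_k T k i j *: e k) *: @syz_gen s j.
Proof.
have [_ _ eG] := eB; have [bP _ bG _] := syz_gen_free s.
have [bP' _ _ _] := syz_gen_free s.+1.
have /choice[c cE] i : exists c : 'I_(syz_rank s) -> 'I_d -> F,
    syz_d hA K s (@syz_gen s.+1 i) = \sum_j (\sum_k c j k *: e k) *: @syz_gen s j.
  have di : syz_d hA K s (@syz_gen s.+1 i) \in gmod_comp (P s) s.+1.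
    by have [/(_ isT)] := syz_d_deg (bP' i); rewrite subn0.
  have [a a1 ->] := bG _ _ (leqnSn s) di.
  have /choice[c cE] j : lincomb e (a j) by apply: eG; have := a1 j; rewrite subSnn.
  by exists c; apply: eq_bigr => j _; rewrite {1}cE.
exists (fun k => \matrix_(i, j) c i j k) => i; rewrite cE.
by apply: eq_bigr => j _; congr (_ *: _); apply: eq_bigr => k _; rewrite mxE.
Qed.

(** The first clause is minimality: the differentials of the generators are independent over [F].
    The second is d d = 0, read as quadratic relations of [A]. *)
Lemma koszul_matrices : exists T : forall s, 'I_d -> 'M[F]_(syz_rank s.+1, syz_rank s),
  (forall s (x : 'rV_(syz_rank s.+1)), (forall k, x *m T s k = 0) -> x = 0) /\
  forall s i l, \sum_k \sum_k' (T s.+1 k *m T s k') i l *: (e k * e k') = 0.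
Proof.
pose T s := sval (cid (syz_matrix_ex s)).
have TE s := svalP (cid (syz_matrix_ex s)).
exists T; split=> [s x xT|s i l].
- have [_ bI _] := syz_gen_basis s.+1.
  apply/rowP => i; rewrite mxE; apply: (bI (x 0)); apply: (@syz_incl_inj _ _ _ hA K s).
  rewrite linear0 linear_sum /=.
  under eq_bigr => j _ do rewrite rsE linearZ /= -syz_dE TE scaler_sumr.
  rewrite exchange_big big1 //= => j _.
  under eq_bigr => j' _ do rewrite scalerA -scalerAl mul1r.
  rewrite -scaler_suml; suff -> : \sum_i0 x 0 i0 *: (\sum_k sval (cid (syz_matrix_ex s))
    k i0 j *: e k) = 0.
    by rewrite scale0r.
  under eq_bigr => j' _ do rewrite scaler_sumr.
  rewrite exchange_big big1 //= => k _.
  under eq_bigr => j' _ do rewrite scalerA.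
  rewrite -scaler_suml; have /rowP/(_ j) := xT k; rewrite !mxE => xk.
  by rewrite [X in X *: _](_ : _ = 0) ?scale0r.
- have [_ _ _ bI] := syz_gen_free s.
  have dd : syz_d hA K s (syz_d hA K s.+1 (@syz_gen s.+2 i)) = 0.
    by apply/syz_d_eq0; exists (@syz_gen s.+2 i).
  have TZ j (a : A) : syz_d hA K s (a *: @syz_gen s.+1 j)
      = \sum_l (a * \sum_k T s k j l *: e k) *: @syz_gen s l.
    rewrite linearZ_LR TE scaler_sumr; apply: eq_bigr => l' _; exact: scalerA.
  move: dd; rewrite TE linear_sum.
  under eq_bigr => j _ do rewrite TZ.
  rewrite exchange_big /=.
  under eq_bigr => l' _ do rewrite -scaler_suml.
  move/bI/(_ l) => TT0; rewrite -[RHS]TT0.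
  under [RHS]eq_bigr => j _ do rewrite big_distrlr.
  rewrite [RHS]exchange_big; apply: eq_bigr => k _.
  rewrite [RHS]exchange_big; apply: eq_bigr => k' _.
  rewrite mxE scaler_suml; apply: eq_bigr => j _ /=.
  by rewrite -scalerAl -scalerAr scalerA.
Qed.

End Matrices.

End DiagonalResolution.

(** * Alternating tensors and the Euler characteristic *)

Section Antisymmetry.
Variables (F : fieldType) (d : nat) (m : nat -> nat).
Variable T : forall s, 'I_d -> 'M[F]_(m s.+1, m s).
Hypothesis Tinj : forall s (x : 'rV_(m s.+1)), (forall k, x *m T s k = 0) -> x = 0.
Hypothesis Talt : forall s k, T s.+1 k *m T s k = 0.
Hypothesis Tanti : forall s k l, T s.+1 k *m T s l = - (T s.+1 l *m T s k).

(* x stands for an alternating tensor of degree s + 1 in d variables, and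
   x *m T s k for its contraction with the k-th variable. *)
Lemma killed_eq0 s (x : 'rV_(m s.+1)) (J : {set 'I_d}) :
  (forall k, k \in J -> x *m T s k = 0) -> (d < #|J| + s.+1)%N -> x = 0.
Proof.
elim: s x J => [|s IH] x J xJ dJ; apply: Tinj => k; have [/xJ //|kJ] := boolP (k \in J).
  have : (#|k |: J| <= #|'I_d|)%N by exact: max_card.
  by rewrite cardsU1 kJ card_ord add1n leqNgt -[#|J|.+1]addn1 dJ.
(* Contraction with a new [k] lowers the degree by one and adds [k] to the variables that kill the
   tensor, so the sum compared with [d] does not change. *)
apply: (IH _ (k |: J)) => [l|]; last by rewrite cardsU1 kJ; lia.
rewrite !inE -mulmxA => /orP[/eqP ->|lJ]; first by rewrite Talt mulmx0.
by rewrite Tanti mulmxN mulmxA xJ // mul0mx oppr0.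
Qed.

Lemma rank_eq0 s : (d <= s)%N -> m s.+1 = 0%N.
Proof.
move=> ds; have x0 (x : 'rV[F]_(m s.+1)) : x = 0.
  by apply: (@killed_eq0 s x finset.set0) => [k|]; rewrite ?inE // cards0; lia.
apply/eqP; rewrite -leqn0 leqNgt; apply/negP => m0.
have /rowP/(_ (Ordinal m0)) := x0 (const_mx 1).
by rewrite !mxE => /eqP; rewrite oner_eq0.
Qed.

End Antisymmetry.

(** * The Euler characteristic polynomial, determined on the unit interval *)

Section RealAnalysis.
Variable R : realType.
Implicit Types (q : {poly R}) (t : R).

Lemma horner_bounded q : exists C, 0 <= C /\ forall t, 0 <= t <= 1 -> `|q.[t]| <= C.
Proof.
exists (\sum_(i < size q) `|q`_i|); split=> [|t /andP[t0 t1]].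
  by apply: sumr_ge0.
rewrite horner_coef (le_trans (ler_norm_sum _ _ _)) // ler_sum // => i _.
by rewrite normrM ler_piMr // ger0_norm ?exprn_ge0 // exprn_ile1.
Qed.

(** Writing q(t) - q(1) = h(t)(t - 1) with |h| <= C on [0, 1] gives |q(1)| <= (1 - t)(1 + C), and
    [t] can be taken close to 1. *)
Lemma horner1_eq0 q : (forall t, 0 < t < 1 -> `|q.[t]| <= 1 - t) -> q.[1] = 0.
Proof.
move=> qt; have /factor_theorem[h hE] : root (q - q.[1]%:P) 1.
  by rewrite rootE !hornerE subrr.
have [C [C0 hC]] := horner_bounded h.
have bnd t : 0 < t < 1 -> `|q.[1]| <= (1 - t) * (1 + C).
  move=> t01; have /andP[t0 t1] := t01.
  have := congr1 (fun p => p.[t]) hE; rewrite !hornerE => e.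
  have -> : q.[1] = q.[t] - h.[t] * (t - 1) by rewrite -e; ring.
  apply: (le_trans (ler_normB _ _)); rewrite [leRHS]mulrDr mulr1 lerD ?qt //.
  have s0 : 0 <= 1 - t by rewrite subr_ge0 ltW.
  rewrite normrM mulrC [`|t - 1|]distrC [`|1 - t|]ger0_norm //.
  by apply: ler_wpM2l => //; apply: hC; rewrite !ltW.
apply/eqP; rewrite -normr_eq0; apply/negPn/negP => q1.
have q1p : 0 < `|q.[1]| by rewrite lt_neqAle eq_sym q1 normr_ge0.
set a := `|q.[1]| in q1p bnd *.
have Ca : 0 <= C * a by rewrite mulr_ge0 // ltW.
(* At t = 1 - a / D the bound, multiplied by 2 (1 + a), reads 2 a (1 + a) <= a, impossible for a >
   0; the factor 1 + a keeps a / D below 1. *)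
pose D := 2 * (1 + C) * (1 + a); have D0 : 0 < D by rewrite /D; lra.
have xE : a / D * D = a by rewrite mulfVK // gt_eqF.
have xp : 0 < a / D by rewrite divr_gt0.
have x1 : a / D < 1 by rewrite ltr_pdivrMr // mul1r /D; lra.
have := bnd (1 - a / D); rewrite subr_gt0 x1 ltrBlDr ltrDl xp => /(_ isT).
rewrite opprB addrC subrK => le_a.
have : a * (2 * (1 + a)) <= a / D * (1 + C) * (2 * (1 + a)).
  by rewrite ler_wpM2r //; lra.
have -> : a / D * (1 + C) * (2 * (1 + a)) = a by rewrite -[RHS]xE /D; ring.
have : 0 < a * a by exact: mulr_gt0.
lra.
Qed.

(** The bound forces a zero at 1; dividing by 1 - t, which is positive on the open interval, gives
    the same bound with [d] lowered by one. *)
Lemma poly_le_pow d q : (forall t, 0 < t < 1 -> 0 <= q.[t] <= (1 - t) ^+ d) ->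
  exists g, q = g * (1 - 'X) ^+ d.
Proof.
elim: d q => [|d IH] q qt; first by exists q; rewrite expr0 mulr1.
have /eqP : q.[1] = 0.
  apply: horner1_eq0 => t t01; have /andP[q0 qd] := qt _ t01; have /andP[t0 t1] := t01.
  have s0 : 0 <= 1 - t by rewrite subr_ge0 ltW.
  have s1 : 1 - t <= 1 by rewrite gerBl ltW.
  by rewrite ger0_norm //; apply: (le_trans qd); rewrite exprS ler_piMr ?exprn_ile1.
move=> /factor_theorem[h hE].
have qE : q = - h * (1 - 'X) by rewrite hE; ring.
have [|g gE] := IH (- h).
  move=> t t01; have := qt _ t01; have /andP[t0 t1] := t01.
  have s0 : 0 < 1 - t by rewrite subr_gt0.
  rewrite {1 2}qE !hornerE exprSr pmulr_lge0 // ler_pM2r //.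
by exists g; rewrite qE gE exprSr mulrA.
Qed.

Variables (u m : nat -> nat) (d : nat).
Hypothesis euler : forall n,
  \sum_(s < n.+1) (-1) ^+ s * (m s * u (n - s))%:R = (n == 0%N)%:R :> int.
Hypothesis m_eq0 : forall s, (d < s)%N -> m s = 0%N.
Hypothesis u_bounded : forall t, 0 < t < 1 ->
  exists B, forall N, \sum_(n < N) (u n)%:R * t ^+ n <= B.
(** A truncation of the lower bound (1 - t)^-d in which both sides are finite sums; [K] tends to
    infinity in [q_bounds]. *)
Hypothesis u_large : forall t K, 0 < t < 1 ->
  (\sum_(k < K) t ^+ k) ^+ d <= \sum_(n < (d * K).+1) (u n)%:R * t ^+ n.

Let q : {poly R} := \poly_(s < d.+1) ((-1) ^+ s * (m s)%:R).

Let S t N := \sum_(n < N) (u n)%:R * t ^+ n.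

(** A finite form of q(t) times the Hilbert series: the partial sums are cut so that exactly the
    total degrees below [M] occur, hence the value is 1 without an error term. *)
Lemma euler_partial t M : (0 < M)%N ->
  \sum_(s < M) (-1) ^+ s * (m s)%:R * t ^+ s * S t (M - s) = 1.
Proof.
pose c M := \sum_(s < M) (-1) ^+ s * (m s)%:R * t ^+ s * S t (M - s).
have cS k : c k.+1 = c k + (k == 0%N)%:R.
  have e := congr1 (fun z : int => z%:~R : R) (euler k).
  rewrite rmorph_sum /= in e.
  have -> : (k == 0%N)%:R = ((k == 0%N)%:R : R) * t ^+ k by case: k {e} => [|k];
    rewrite ?mulr1 ?mul0r.
  have -> : (k == 0%N)%:R = ((k == 0%N)%:R : int)%:~R :> R by case: eqP.
  rewrite -e mulr_suml.
  (* The added term [s = k] is zero because [S t 0] is an empty sum; now the two sums have the same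
     range. *)
  have -> : c k = \sum_(s < k.+1) (-1) ^+ s * (m s)%:R * t ^+ s * S t (k - s).
    by rewrite big_ord_recr /= subnn /S big_ord0 mulr0 addr0.
  rewrite -big_split /=; apply: eq_bigr => -[s /= sk] _.
  rewrite subSn // /S big_ord_recr /= rmorphM rmorphXn rmorphN rmorph1 rmorph_nat natrM.
  rewrite -[in t ^+ k](subnKC (ltnSE sk)) exprD; ring.
case: M => // M _; elim: M => [|M IH]; rewrite -/(c _) cS; first by rewrite /c big_ord0 add0r.
by rewrite [c _]IH addr0.
Qed.

Lemma u0 : u 0 = 1%N /\ m 0 = 1%N.
Proof.
have := euler 0; rewrite big_ord1 expr0 mul1r subnn eqxx.
by move/eqP; rewrite eqr_nat muln_eq1 => /andP[/eqP -> /eqP ->].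
Qed.

(** Let [M] tend to infinity in [euler_partial]. Only [d + 1] terms survive, so the limit is taken
    termwise; [M = N + d.+1] avoids truncated subtraction. *)
Lemma series_inverse t : 0 < t < 1 -> exists P,
  q.[t] * P = 1 /\ forall N, S t N <= P.
Proof.
move=> t01; have [B SB] := u_bounded t01; have /andP[t0 t1] := t01.
have Snd : nondecreasing_seq (S t).
  apply/nondecreasing_seqP => N; rewrite /S big_ord_recr /= lerDl.
  by rewrite mulr_ge0 // exprn_ge0 // ltW.
have Scvg : cvgn (S t).
  apply: nondecreasing_is_cvgn => //; exists B => _ [N _ <-]; exact: SB.
exists (limn (S t)); split; last by move=> N; exact: nondecreasing_cvgn_le.
have lim1 : (fun N => \sum_(s < d.+1) (-1) ^+ s * (m s)%:R * t ^+ s * S t (N + (d.+1 - s)))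
    @ \oo --> \sum_(s < d.+1) (-1) ^+ s * (m s)%:R * t ^+ s * limn (S t).
  apply: cvg_big => [|s _]; first exact: add_continuous.
  apply: cvgM; first exact: cvg_cst.
  by rewrite (cvg_shiftn (d.+1 - s) (S t)).
have -> : q.[t] * limn (S t) = \sum_(s < d.+1) (-1) ^+ s * (m s)%:R * t ^+ s * limn (S t).
  by rewrite horner_poly mulr_suml.
apply/esym; move: lim1; apply: cvg_unique => //.
rewrite (_ : (fun N => _) = cst 1); first exact: cvg_cst.
apply/funext => N; rewrite /=.
have M0 : (0 < N + d.+1)%N by rewrite addnS.
apply: etrans (euler_partial t M0).
rewrite -[RHS](big_mkord xpredT (fun s => (-1) ^+ s * (m s)%:R * t ^+ s * S t (N
  + d.+1 - s))).
rewrite (big_cat_nat (n := d.+1)) ?leq_addl //= big_mkord.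
rewrite [X in _ = _ + X]big_nat_cond [X in _ = _ + X]big1 ?addr0.
  by apply: eq_bigr => -[s sd] _ /=; rewrite addnBA // ltnW.
by move=> s /andP[/andP[ds _] _]; rewrite m_eq0 // mulr0 !mul0r.
Qed.

Lemma q_bounds t : 0 < t < 1 -> 0 <= q.[t] <= (1 - t) ^+ d.
Proof.
move=> t01; have [P [qP SP]] := series_inverse t01; have /andP[t0 t1] := t01.
have P0 : 0 < P.
  apply: lt_le_trans (SP 1%N).
  by rewrite /S big_ord1 u0.1 expr0 mulr1.
have q0 : 0 <= q.[t] by rewrite -(pmulr_lge0 _ P0) qP.
rewrite q0 /=.
(* The geometric sum is (1 - t^K) / (1 - t), and q(t) times its d-th power is at most q(t) P = 1. *)
have main K : q.[t] * (1 - t ^+ K) ^+ d <= (1 - t) ^+ d.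
  have -> : 1 - t ^+ K = (1 - t) * \sum_(k < K) t ^+ k.
    by rewrite -[LHS]opprB subrX1 -mulNr opprB.
  have s0 : 0 <= 1 - t by rewrite subr_ge0 ltW.
  rewrite exprMn mulrCA ler_piMr ?exprn_ge0 //.
  suff : q.[t] * (\sum_(k < K) t ^+ k) ^+ d <= q.[t] * P by rewrite qP.
  by apply: ler_wpM2l => //; exact: le_trans (u_large K t01) (SP _).
have lim1 : (fun K => q.[t] * (1 - t ^+ K) ^+ d) @ \oo --> q.[t] * (1 - 0) ^+ d.
  apply: cvgM; first exact: cvg_cst.
  elim: (d) => [|e IH]; first by under eq_fun do rewrite expr0; exact: cvg_cst.
  under eq_fun do rewrite exprS.
  rewrite exprS; apply: cvgM => //.
  by apply: cvgB; [exact: cvg_cst | apply: cvg_expr; rewrite ger0_norm ?ltW].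
have : q.[t] * (1 - 0) ^+ d <= (1 - t) ^+ d.
  by apply: (ler_cvg_to lim1 (cvg_cst _)); exact: nearW.
by rewrite subr0 expr1n mulr1.
Qed.

Lemma euler_poly : q = (1 - 'X) ^+ d.
Proof.
have [g gE] := poly_le_pow q_bounds.
have sX : size ((1 - 'X : {poly R}) ^+ d) = d.+1.
  have -> : 1 - 'X = - ('X - 1%:P) :> {poly R} by rewrite opprB.
  by rewrite exprNn size_Msign size_exp_XsubC.
have q1 : q.[0] = 1 by rewrite horner_coef0 coef_poly /= u0.2 expr0 mul1r.
have g0 : g != 0.
  by apply: contra_eq_neq q1 => g0; rewrite gE g0 mul0r horner0 eq_sym oner_eq0.
have X0 : (1 - 'X : {poly R}) ^+ d != 0 by rewrite -size_poly_eq0 sX.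
have sq : (size q <= d.+1)%N by exact: size_poly.
have : (size g <= 1)%N.
  by move: sq; rewrite gE size_mul // sX addnS /= -[d.+1]add1n leq_add2r.
move=> /size1_polyC gC; rewrite gE gC.
have : q.[0] = g`_0 by rewrite gE {1}gC !(hornerE, horner_exp) subr0 expr1n mulr1.
by rewrite q1 => <-; rewrite mul1r.
Qed.

Lemma euler_coef s : (s <= d)%N -> m s = 'C(d, s).
Proof.
move=> sd; have : q`_s = (-1) ^+ s * ('C(d, s))%:R.
  rewrite euler_poly (_ : _ ^+ d = \poly_(i < d.+1) ((-1) ^+ i * ('C(d, i))%:R)).
    by rewrite coef_poly ltnS sd.
  rewrite poly_def exprDn; apply: eq_bigr => i _.
  rewrite expr1n mul1r [(- 'X) ^+ i]exprNn -mul_polyC polyCM polyC_exp polyCN polyC1.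
  by rewrite polyC_natr mulrAC mulr_natr.
rewrite coef_poly ltnS sd => /(mulfI _) /eqP.
by rewrite eqr_nat => H; apply/eqP/H; rewrite signr_eq0.
Qed.

(** The coefficient of t^2 in the Euler relation, with m_1 = u_1 from the coefficient of t; stated
    additively to avoid truncated subtraction. *)
Lemma u2E : u 1 = d -> (u 2 + 'C(d, 2) = d * d)%N.
Proof.
move=> u1d; have [u01 m01] := u0.
have e1 : m 1 = u 1.
  have := euler 1; rewrite !big_ord_recl big_ord0 /bump /= subn0 subnn u01 m01.
  by rewrite !muln1 mul1n expr0 expr1 mul1r mulN1r addr0 => /eqP;
    rewrite subr_eq0 eqr_nat => /eqP.
have m2 : m 2 = 'C(d, 2).
  by have [d2|d2] := leqP 2 d; [exact: euler_coef | rewrite m_eq0 // bin_small].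
have := euler 2; rewrite !big_ord_recl big_ord0 /bump /= subn0 subnn u01 m01 e1 m2.
rewrite -[(2 - 1)%N]/1%N u1d expr0 expr1 sqrrN expr1n !mul1r mulN1r mul1n muln1 addr0.
move=> e; apply/eqP; rewrite -(eqr_nat int) natrD -subr_eq0; apply/eqP.
by apply: etrans e; ring.
Qed.

End RealAnalysis.

(** * Enveloping algebras of graded Lie algebras *)

Section LieGradings.
Variables (F : fieldType) (L : lieAlgType F) (gr : nat -> submodClosed L).
Hypothesis hgr : graded_lie gr.

Let grZ k : zmod_closed (gr k). Proof. exact: submod_zmod_closed. Qed.
Let grG : is_grading (fun k => gr k). Proof. exact: graded_lie_sum hgr. Qed.
Local Notation pr := (gproj (fun k => gr k)).

Lemma lieDl (x y z : L) : lie (x + y) z = lie x z + lie y z.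
Proof. by rewrite -[x]scale1r lie_linearl !scale1r. Qed.
Lemma lieDr (x y z : L) : lie x (y + z) = lie x y + lie x z.
Proof. by rewrite -[y]scale1r lie_linearr !scale1r. Qed.
Lemma lie0l (x : L) : lie 0 x = 0.
Proof. by apply: (addrI (lie 0 x)); rewrite -lieDl !addr0. Qed.
Lemma lie0r (x : L) : lie x 0 = 0.
Proof. by apply: (addrI (lie x 0)); rewrite -lieDr !addr0. Qed.
Lemma lieZl a (x y : L) : lie (a *: x) y = a *: lie x y.
Proof. by rewrite -[a *: x]addr0 lie_linearl lie0l addr0. Qed.
Lemma lieZr a (x y : L) : lie x (a *: y) = a *: lie x y.
Proof. by rewrite -[a *: y]addr0 lie_linearr lie0r addr0. Qed.
Lemma lieC (x y : L) : lie x y = - lie y x.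
Proof.
apply/eqP; rewrite -addr_eq0; apply/eqP.
by have := lie_alt (x + y); rewrite lieDl !lieDr !lie_alt add0r addr0.
Qed.
Lemma lie_suml (I : Type) (r : seq I) (P : pred I) (f : I -> L) y :
  lie (\sum_(i <- r | P i) f i) y = \sum_(i <- r | P i) lie (f i) y.
Proof. by elim/big_rec2: _ => [|i a b _ <-]; rewrite ?lie0l ?lieDl. Qed.
Lemma lie_sumr (I : Type) (r : seq I) (P : pred I) (f : I -> L) y :
  lie y (\sum_(i <- r | P i) f i) = \sum_(i <- r | P i) lie y (f i).
Proof. by elim/big_rec2: _ => [|i a b _ <-]; rewrite ?lie0r ?lieDr. Qed.

Lemma gproj0_lie x : pr x 0 = 0.
Proof. by apply: (graded_lie0 hgr); exact: (gproj_mem grZ grG). Qed.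

(** Both ranges are at least 2 so that [gproj_lie2] can single out the index 1 in each. *)
Lemma gproj_lie x y k : exists n m, [/\ (2 <= n)%N, (2 <= m)%N &
  pr (lie x y) k = \sum_(i < n) \sum_(j < m)
    if (i + j == k)%N then lie (pr x i) (pr y j) else 0].
Proof.
have [n xE] := gproj_sum grZ grG x; have [m yE] := gproj_sum grZ grG y.
exists (maxn 2 n), (maxn 2 m); split; [exact: leq_maxl | exact: leq_maxl |].
have [q qE] := gproj_linear_ex grG k.
rewrite {1}(xE (maxn 2 n)) ?leq_maxr // {1}(yE (maxn 2 m)) ?leq_maxr //.
rewrite lie_suml -qE linear_sum; apply: eq_bigr => i _.
rewrite lie_sumr linear_sum; apply: eq_bigr => j _; rewrite /= qE.
by rewrite (gproj_id grZ grG _ (graded_lie_lie hgr (gproj_mem grZ grG x i) (gproj_mem grZ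
  grG y j))) eq_sym.
Qed.

Lemma gproj_lie1 x y : pr (lie x y) 1 = 0.
Proof.
have [n [m [_ _ ->]]] := gproj_lie x y 1.
rewrite big1 // => -[[|i] /= _] _; rewrite big1 // => -[[|j] /= _] _.
- by [].
- by case: ifP; rewrite ?gproj0_lie ?lie0l.
- by case: ifP; rewrite ?gproj0_lie ?lie0r.
- by rewrite addSn addnS.
Qed.

Lemma gproj_lie2 x y : pr (lie x y) 2 = lie (pr x 1) (pr y 1).
Proof.
have [n [m [n2 m2 ->]]] := gproj_lie x y 2.
rewrite (bigD1 (Ordinal n2)) //= (bigD1 (Ordinal m2)) //=.
rewrite [X in _ + X + _]big1 => [|j jn]; last first.
  case: eqP => // j1; case/eqP: jn; apply: val_inj => /=; lia.
rewrite addr0 big1 ?addr0 // => i ni; rewrite big1 // => j _.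
case: eqP => // ij; have [i0|i0] := posnP i; first by rewrite i0 gproj0_lie lie0l.
have [j0|j0] := posnP j; first by rewrite j0 gproj0_lie lie0r.
by case/eqP: ni; apply: val_inj => /=; lia.
Qed.

(** If i + j = k > 2 with [i] and [j] positive, one of them lies between 2 and k - 1; so brackets
    never reach the first nonzero component above degree 2. *)
Lemma gproj_lie_gt2 x y k : (2 < k)%N ->
  (forall j z, (2 <= j < k)%N -> z \in gr j -> z = 0) -> pr (lie x y) k = 0.
Proof.
move=> k2 low; have [n [m [_ _ ->]]] := gproj_lie x y k.
rewrite big1 // => -[i ] /= _ _; rewrite big1 // => -[j] /= _ _; case: eqP => // ijk.
have [i1|i2] := leqP i 1.
  case: i i1 ijk => [|[|]] // _ ijk; first by rewrite gproj0_lie lie0l.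
  by rewrite [pr y j](low j) ?lie0r //; [lia | exact: (gproj_mem grZ grG)].
have [ik|ki] := ltnP i k.
  by rewrite [pr x i](low i) ?lie0l //; [lia | exact: (gproj_mem grZ grG)].
have -> : j = 0%N by lia.
by rewrite gproj0_lie lie0r.
Qed.

End LieGradings.

Section EnvelopingGradings.
Variables (F : fieldType) (L : lieAlgType F) (gr : nat -> submodClosed L).
Hypothesis hgr : graded_lie gr.
Variables (U : algType F) (iota : {linear L -> U}).
Hypothesis hU : is_enveloping_algebra iota.

Let grZ k : zmod_closed (gr k). Proof. exact: submod_zmod_closed. Qed.
Let grG : is_grading (fun k => gr k). Proof. exact: graded_lie_sum hgr. Qed.
Local Notation pr := (gproj (fun k => gr k)).
Local Notation Ugr := (enveloping_grading iota gr).

Lemma envelope_ext (B : algType F) (f : {linear L -> B}) : is_lie_hom f ->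
  exists g : {lrmorphism U -> B}, forall x, g (iota x) = f x.
Proof. by move=> fL; case: (hU.2 B f fL). Qed.

Lemma iota_lie x y : iota (lie x y) = iota x * iota y - iota y * iota x.
Proof. exact: hU.1. Qed.

Lemma envelope_eps : exists eps : {lrmorphism U -> F^o}, forall x, eps (iota x) = 0.
Proof.
have [f fE] : exists f : {linear L -> F^o}, forall x, f x = 0.
  by apply: linear_ex => a x y; rewrite scaler0 addr0.
have [|eps epsE] := @envelope_ext F^o f; first by move=> x y; rewrite !fE mulr0 subrr.
by exists eps => x; rewrite epsE fE.
Qed.

(** These representations stand in for the injectivity part of Poincare-Birkhoff-Witt: what [f1] or
    [f2] detects is not killed by [iota]. *)
Lemma nil3_rep (V W : lmodType F) (b : bilin V W) (f1 : {linear L ->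
  V}) (f2 : {linear L -> W}) :
  (forall x y, f1 (lie x y) = 0) ->
  (forall x y, f2 (lie x y) = b (f1 x) (f1 y) - b (f1 y) (f1 x)) ->
  exists g : {lrmorphism U -> nil3_alg b}, forall x, g (iota x) = nil3_mk b 0 (f1 x) (f2 x).
Proof.
move=> f1l f2l.
have fl : linear (fun x => nil3_mk b 0 (f1 x) (f2 x)).
  move=> a x y; rewrite !linearP; congr ((_, _), _) => /=; by rewrite ?scaler0 ?addr0.
have [f fE] := linear_ex fl.
have [|g gE] := @envelope_ext (nil3_alg b) f; last by exists g => x; rewrite gE fE.
by move=> x y; rewrite !fE nil3_commutator f1l f2l.
Qed.

Lemma bilin0_ex (V W : lmodType F) : exists b : bilin V W, forall x y, b x y = 0.
Proof.
have e (a : F) : 0 = a *: 0 + 0 :> W by rewrite scaler0 addr0.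
by exists (@Bilin F V W (fun _ _ => 0) (fun _ a _ _ => e a) (fun _ a _ _ => e a)).
Qed.

(** Projection to degree one kills brackets, so it is a Lie homomorphism to an abelian Lie algebra
    and extends to [U]. *)
Lemma iota_inj1 x : x \in gr 1%N -> iota x = 0 -> x = 0.
Proof.
move=> x1 ix; have [b b0] := bilin0_ex L L; have [p pE] := gproj_linear_ex grG 1.
have [z zE] : exists z : {linear L -> L}, forall x, z x = 0.
  by apply: linear_ex => a u v; rewrite scaler0 addr0.
have [u v|u v|g gE] := @nil3_rep _ _ b p z.
- by rewrite pE gproj_lie1.
- by rewrite zE !b0 subrr.
have := gE x; rewrite ix raddf0 pE (gproj_id grZ grG _ x1) eqxx.
by case=> <-.
Qed.

(** The words spanning [enveloping_grading] may contain letters of degree 0; those letters are zero,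
    so only words in positive degrees count. *)
Lemma prod_eq0 (s : seq (nat * L)) :
  (forall p, p \in s -> p.2 \in gr p.1) -> has (fun p => p.1 == 0%N) s ->
  \prod_(p <- s) iota p.2 = 0.
Proof.
elim: s => // p s IH sg /= /orP[/eqP p0|/IH ps].
  have p2 : p.2 = 0 by apply: (graded_lie0 hgr); rewrite -p0; apply: sg; rewrite inE eqxx.
  by rewrite big_cons p2 linear0 mul0r.
by rewrite big_cons ps ?mulr0 // => q qs; apply: sg; rewrite inE qs orbT.
Qed.

Lemma Ugr_iota n x : x \in gr n -> iota x \in Ugr n.
Proof.
move=> xn; apply: lin_span_gen; exists [:: (n, x)]; split=> /=.
- by move=> p; rewrite inE => /eqP->.
- by rewrite addn0.
- by rewrite big_seq1.
Qed.

Lemma Ugr1_iota u : u \in Ugr 1%N -> exists2 x, x \in gr 1%N & u = iota x.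
Proof.
move/asboolP => [n [c [v [vP ->]]]].
have /choice[w wP] : forall i, exists x, x \in gr 1%N /\ v i = iota x.
  move=> i; have [s [sg s1 ->]] := vP i.
  have [s0|s0] := boolP (has (fun p => p.1 == 0%N) s).
    by exists 0; rewrite rpred0 linear0 prod_eq0.
  case: s s1 s0 sg => [//|p [|q s]] /= s1 s0 sg.
    exists p.2; rewrite big_seq1; split=> //.
    by have := sg p; rewrite inE eqxx => /(_ isT); rewrite -s1 addn0.
  by move: s0 s1; rewrite !negb_or => /and3P[]; lia.
exists (\sum_i c i *: w i); first by apply: rpred_sum => i _; rewrite rpredZ // (wP i).1.
by rewrite linear_sum; apply: eq_bigr => i _; rewrite linearZ /= (wP i).2.
Qed.

Section Augmentation.
Variable eps : {lrmorphism U -> F^o}.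
Hypothesis epsE : forall x, eps (iota x) = 0.

Lemma eps_Ugr k u : u \in Ugr k.+1 -> eps u = 0.
Proof.
move/asboolP => [n [c [v [vP ->]]]]; rewrite linear_sum big1 // => i _.
rewrite linearZ /=; have [[|p s] [_ //= _ ->]] := vP i.
by rewrite big_cons rmorphM /= epsE mul0r scaler0.
Qed.

Lemma Ugr0E u : u \in Ugr 0%N -> u = (eps u : F)%:A.
Proof.
move/asboolP => [n [c [v [vP ->]]]].
rewrite linear_sum scaler_suml; apply: eq_bigr => i _; rewrite linearZ /= -scalerA.
congr (_ *: _); have [s [sg s0 ->]] := vP i; case: s s0 sg => [_ _|p s s0 sg].
  by rewrite big_nil rmorph1 scale1r.
rewrite prod_eq0 //; first by rewrite linear0 scale0r.
by move: s0; rewrite /= => /eqP; rewrite addn_eq0 => /andP[->].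
Qed.

End Augmentation.

Section Generators.
Variables (d : nat) (e : 'I_d -> L).
Hypothesis eB : is_basis (gr 1%N) e.

Lemma coord1 : exists c : 'I_d -> {linear L -> F^o},
  forall x, pr x 1 = \sum_i (c i x : F) *: e i.
Proof.
have [p pE] := gproj_linear_ex grG 1.
have [|c cE] := basis_coord_linear (p := p) eB.
  by move=> x; rewrite pE; exact: (gproj_mem grZ grG).
by exists c => x; rewrite -pE cE.
Qed.

Lemma coord1_e (c : 'I_d -> {linear L -> F^o}) :
  (forall x, pr x 1 = \sum_i (c i x : F) *: e i) ->
  forall i j, c i (e j) = (i == j)%:R.
Proof.
move=> cE i j; have [eg eI _] := eB; apply/eqP; rewrite -subr_eq0; apply/eqP.
apply: (eI (fun i => c i (e j) - (i == j)%:R)).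
under eq_bigr => k _ do rewrite scalerBl.
rewrite sumrB -cE (gproj_id grZ grG _ (eg j)) eqxx (bigD1 j) //= eqxx scale1r.
rewrite big1 ?addr0 ?subrr // => k /negbTE->; exact: scale0r.
Qed.

Lemma coord1_lie (c : 'I_d -> {linear L -> F^o}) :
  (forall x, pr x 1 = \sum_i (c i x : F) *: e i) ->
  forall i x y, c i (lie x y) = 0.
Proof.
move=> cE i x y; have [_ eI _] := eB.
by apply: (eI (fun i => c i (lie x y))); rewrite -cE gproj_lie1.
Qed.

(* A basis e_1, ..., e_d gives the cochain b(x, y) = sum_(i < j) x_i y_j [e_i, e_j],
   whose antisymmetrization is the bracket. *)
Lemma iota_inj2 x : x \in gr 2%N -> iota x = 0 -> x = 0.
Proof.
move=> x2 ix; have [p1 p1E] := gproj_linear_ex grG 1; have [p2 p2E] := gproj_linear_ex grG 2.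
have [c cE] := coord1.
pose bf (x y : L) : L := \sum_(i : 'I_d) \sum_(j : 'I_d | (i < j)%N) ((c i x : F) * c j
  y) *: lie (e i) (e j).
have bl y a u v : bf (a *: u + v) y = a *: bf u y + bf v y.
  rewrite /bf scaler_sumr -big_split; apply: eq_bigr => i _.
  rewrite scaler_sumr -big_split; apply: eq_bigr => j _.
  by rewrite linearP mulrDl scalerDl scalerA mulrA.
have br y a u v : bf y (a *: u + v) = a *: bf y u + bf y v.
  rewrite /bf scaler_sumr -big_split; apply: eq_bigr => i _.
  rewrite scaler_sumr -big_split; apply: eq_bigr => j _.
  by rewrite linearP mulrDr scalerDl scalerA mulrCA.
have cp1 i y : c i (p1 y) = c i y.
  apply/eqP; rewrite -subr_eq0 -linearB; apply/eqP; have [_ eI _] := eB.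
  apply: (eI (fun i => c i (p1 y - y))); rewrite -cE (gprojB grZ grG).
  by rewrite p1E (gproj_id grZ grG _ (gproj_mem grZ grG y 1)) eqxx subrr.
have [u v|u v|g gE] := @nil3_rep _ _ (Bilin bl br) p1 p2.
- by rewrite p1E gproj_lie1.
- pose t (i j : 'I_d) : L := ((c i u : F) * c j v) *: lie (e i) (e j).
  have lieE : lie (pr u 1) (pr v 1) = \sum_i \sum_j t i j.
    rewrite !cE lie_suml; apply: eq_bigr => i _; rewrite lieZl lie_sumr scaler_sumr.
    by apply: eq_bigr => j _; rewrite lieZr scalerA.
  (* Exchanging the arguments of [bf] produces minus the lower triangle. The diagonal vanishes
     because the bracket is alternating, so no division by 2 occurs. *)
  have bfE : bf v u = - \sum_(i : 'I_d) \sum_(j : 'I_d | (j < i)%N) t i j.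
    rewrite [in RHS](exchange_big_dep xpredT) //= -sumrN; apply: eq_bigr => i _.
    by rewrite -sumrN; apply: eq_bigr => j _; rewrite /t mulrC lieC scalerN.
  rewrite p2E gproj_lie2 // lieE.
  have cpE x' y' : bf (p1 x') (p1 y') = bf x' y'.
    by apply: eq_bigr => i _; apply: eq_bigr => j _; rewrite !cp1.
  rewrite /= !cpE bfE opprK -big_split; apply: eq_bigr => i _ /=.
  rewrite (bigID (fun j : 'I_d => (i < j)%N)) /=; congr (_ + _).
  rewrite (bigD1 i) ?ltnn //= /t lie_alt scaler0 add0r.
  by apply: eq_bigl => j; rewrite -leqNgt [RHS]ltn_neqAle andbC.
have := gE x; rewrite ix raddf0 p2E (gproj_id grZ grG _ x2) eqxx.
by case=> _ <-.
Qed.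

(* Kronecker substitution: for w i = B ^ i the monomials with all exponents
   below B have distinct images. *)
Lemma poly_rep (w : 'I_d -> nat) :
  exists g : {lrmorphism U -> {poly F}}, forall i, g (iota (e i)) = 'X^(w i).
Proof.
have [c cE] := coord1.
have fl : linear (fun x => \sum_i (c i x : F) *: 'X^(w i) : {poly F}).
  move=> a x y; rewrite scaler_sumr -big_split; apply: eq_bigr => i _.
  by rewrite linearP scalerDl scalerA.
have [f fE] := linear_ex fl.
have [|g gE] := @envelope_ext {poly F} f.
  move=> x y; rewrite mulrC subrr fE big1 // => i _.
  by rewrite (coord1_lie cE) scale0r.
exists g => i; rewrite gE fE (bigD1 i) //= (coord1_e cE) eqxx scale1r big1 ?addr0 // => j ji.
by rewrite (coord1_e cE) (negbTE ji) scale0r.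
Qed.

End Generators.

End EnvelopingGradings.

(** * Poincare-Birkhoff-Witt spanning *)

Section OrderedMonomials.
Variables (F : fieldType) (U : algType F).

(* An entry of ys is a pair (weight, element). *)
Fixpoint mon (ys : seq (nat * U)) (n : nat) : seq U :=
  match ys with
  | [::] => if n == 0%N then [:: 1] else [::]
  | (w, y) :: ys' =>
      flatten [seq [seq y ^+ a * s | s <- mon ys' (n - a * w)]
              | a <- [seq a <- iota 0 n.+1 | (a * w <= n)%N]]
  end.

Lemma mon_cons w y ys n : mon ((w, y) :: ys) n =
  flatten [seq [seq y ^+ a * s | s <- mon ys (n - a * w)]
          | a <- [seq a <- iota 0 n.+1 | (a * w <= n)%N]].
Proof. by []. Qed.

Lemma mem_mon w y ys n x : (0 < w)%N ->
  (x \in mon ((w, y) :: ys) n) <->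
  exists a s, [/\ (a * w <= n)%N, s \in mon ys (n - a * w) & x = y ^+ a * s].
Proof.
move=> w0; rewrite mon_cons; split=> [/flatten_mapP[a]|[a [s [awn sm ->]]]].
  by rewrite mem_filter => /andP[awn _] /mapP[s sm ->]; exists a, s.
apply/flatten_mapP; exists a; last exact: map_f.
rewrite mem_filter awn mem_iota ltnS /=.
by apply: leq_trans awn; exact: leq_pmulr.
Qed.

Definition mon_span ys n : submodClosed U := lin_span [set` mon ys n].

Lemma mulr_span (S : set U) (W : submodClosed U) (z : U) :
  (forall x, S x -> z * x \in W) -> forall x, x \in lin_span S -> z * x \in W.
Proof.
move=> SW x /asboolP[n [c [v [vS ->]]]]; rewrite mulr_sumr; apply: rpred_sum => i _.
by rewrite -scalerAr; apply: rpredZ; exact: SW.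
Qed.

Lemma mon_span_intro w y ys n a s : (0 < w)%N -> (a * w <= n)%N ->
  s \in mon_span ys (n - a * w) -> y ^+ a * s \in mon_span ((w, y) :: ys) n.
Proof.
move=> w0 awn; apply: mulr_span => x xm; apply: lin_span_gen.
by apply/(mem_mon _ _ _ _ w0); exists a, x.
Qed.

Variables (N : nat) (Y : seq (nat * U)).
Hypothesis Y_gt0 : forall p, p \in Y -> (0 < p.1)%N.
Hypothesis Y_sorted : pairwise (fun p q : nat * U => (p.1 <= q.1)%N) Y.
(** Cutting off at weight [N] allows a finite list of letters: commutators need to be combinations
    of letters only up to that weight. *)
Hypothesis Y_comm : forall p q, p \in Y -> q \in Y -> (p.1 + q.1 <= N)%N ->
  p.2 * q.2 - q.2 * p.2 \in lin_span [set z | (p.1 + q.1, z)%N \in Y].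

Lemma heavier_later pre p ys q : Y = pre ++ p :: ys -> q \in Y -> (p.1 < q.1)%N -> q \in ys.
Proof.
move=> YE; rewrite YE mem_cat inE => /or3P[qpre|/eqP->|//]; last by rewrite ltnn.
move: Y_sorted; rewrite YE pairwise_cat => /and3P[/allrelP/(_ q p qpre)].
by rewrite inE eqxx => /(_ isT) + _ _ => qp; rewrite ltnNge qp.
Qed.

(** A letter from the tail is moved to the right past the leading power of [y], one factor at a
    time. Each exchange adds a commutator, a combination of letters heavier than [y]; by sortedness
    these lie in the tail again. The induction is on the tail, then on the exponent. *)
Lemma mon_span_mul ys : forall pre, Y = pre ++ ys ->
  forall p n s, p \in ys -> (n + p.1 <= N)%N -> s \in mon_span ys n ->
  p.2 * s \in mon_span ys (n + p.1).
Proof.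
elim: ys => // -[w y] ys IH pre YE.
have yY : (w, y) \in Y by rewrite YE mem_cat inE eqxx orbT.
have w0 : (0 < w)%N := Y_gt0 yY.
have YE' : Y = rcons pre (w, y) ++ ys by rewrite cat_rcons.
have ysY p : p \in ys -> p \in Y by move=> pys; rewrite YE mem_cat inE pys !orbT.
have mul_y n s : s \in mon_span ((w, y) :: ys) n -> y * s \in mon_span ((w, y) :: ys) (n + w).
  move/asboolP => [k [c [v [vS ->]]]]; rewrite mulr_sumr; apply: rpred_sum => i _.
  rewrite -scalerAr; apply: rpredZ; have /(mem_mon _ _ _ _ w0)[a [m [awn mm ->]]] := vS i.
  rewrite mulrA -exprS; apply: mon_span_intro => //; first by rewrite mulSn; lia.
  rewrite (_ : n + w - a.+1 * w = n - a * w)%N; last by rewrite mulSn; lia.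
  exact: lin_span_gen.
(* The statement ranges over all letters of the tail, because a commutator replaces [p] by other
   letters. *)
have mul_ya a : forall p n s, p \in ys -> (a * w <= n)%N -> (n + p.1 <= N)%N ->
    s \in mon_span ys (n - a * w) -> p.2 * (y ^+ a * s) \in mon_span ((w, y) :: ys) (n + p.1).
  elim: a => [|a IHa] p n s pys an nN sO.
    rewrite expr0 mul1r -[_ * _]mul1r -(expr0 y); apply: mon_span_intro => //.
    by rewrite mul0n subn0; apply: IH YE' _ _ _ pys nN _; rewrite mul0n subn0 in sO.
  have an' : (a * w <= n - w)%N by move: an; rewrite mulSn; lia.
  have wn : (w <= n)%N by move: an; rewrite mulSn; lia.
  have sO' : s \in mon_span ys (n - w - a * w) by rewrite -subnDA -mulSn.
  have -> : p.2 * (y ^+ a.+1 * s)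
      = y * (p.2 * (y ^+ a * s)) + (p.2 * y - y * p.2) * (y ^+ a * s).
    by rewrite mulrBl exprS !mulrA addrC subrK.
  apply: rpredD.
    rewrite (_ : n + p.1 = n - w + p.1 + w)%N; last by lia.
    by apply: mul_y; apply: IHa => //; lia.
  have pY := ysY _ pys; have p0 := Y_gt0 pY.
  have /asboolP[k [c [v [vS ->]]]] : p.2 * y - y * p.2 \in lin_span [set z | (p.1
    + w, z)%N \in Y].
    by apply: (Y_comm pY yY); apply: leq_trans nN; rewrite addnC leq_add2r.
  rewrite mulr_suml; apply: rpred_sum => i _; rewrite -scalerAl; apply: rpredZ.
  have vys : (p.1 + w, v i)%N \in ys by apply: (heavier_later YE (vS i));
    rewrite /= -[X in (X < _)%N]add0n ltn_add2r.
  rewrite (_ : n + p.1 = n - w + (p.1 + w))%N; last by rewrite addnCA subnK // addnC.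
  apply: (IHa (p.1 + w, v i)%N) => //=.
  by rewrite addnCA subnK // addnC.
move=> [w' z] n s; rewrite inE => /orP[/eqP[-> ->] _|zys nN]; first exact: mul_y.
move: s; apply: mulr_span => _ /(mem_mon _ _ _ _ w0)[a [m [awn mm ->]]].
by apply: (mul_ya a (w', z)) => //; exact: lin_span_gen.
Qed.

Lemma mon_span1 : 1 \in mon_span Y 0.
Proof.
have : forall p, p \in Y -> (0 < p.1)%N by [].
elim: (Y) => [|[w y] ys IH] Y0; first by apply: lin_span_gen => /=; rewrite inE.
rewrite -[1]mul1r -(expr0 y); apply: mon_span_intro => //.
  by apply: (Y0 (w, y)); rewrite inE eqxx.
by rewrite mul0n subn0; apply: IH => p pys; apply: Y0; rewrite inE pys orbT.
Qed.

Lemma mon_span_prod (s : seq (nat * U)) :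
  (forall p, p \in s -> p.2 \in lin_span [set z | (p.1, z) \in Y]) ->
  (sumn [seq p.1 | p <- s] <= N)%N ->
  \prod_(p <- s) p.2 \in mon_span Y (sumn [seq p.1 | p <- s]).
Proof.
elim: s => [|p s IH] sY sN; first by rewrite big_nil; exact: mon_span1.
rewrite big_cons /=; have /asboolP[k [c [v [vS ->]]]] := sY p (mem_head _ _).
rewrite mulr_suml; apply: rpred_sum => i _; rewrite -scalerAl; apply: rpredZ.
have sN' : (sumn [seq q.1 | q <- s] + p.1 <= N)%N by rewrite addnC.
rewrite addnC; apply: (@mon_span_mul Y [::] erefl (p.1, v i) _ _ (vS i) sN').
apply: IH => [q qs|]; first by apply: sY; rewrite inE qs orbT.
exact: leq_trans (leq_addr _ _) sN'.
Qed.

End OrderedMonomials.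

(** * Counting ordered monomials *)

Section MonomialCount.
Variables (R : realType) (F : fieldType) (U : algType F) (t : R).
Hypothesis t01 : 0 < t < 1.

Lemma geometric_le (x : R) n : 0 <= x -> x < 1 -> \sum_(a < n) x ^+ a <= (1 - x)^-1.
Proof.
move=> x0 x1; rewrite -[leRHS]mul1r ler_pdivlMr ?subr_gt0 //.
rewrite -[1 - x]opprB mulrN mulrC -subrX1 opprB gerBl.
exact: exprn_ge0.
Qed.

(** Splitting off the power of the first letter gives a convolution. Its terms are non-negative, so
    its truncation is at most the product of the truncated factors, one of which is geometric. *)
Lemma mon_count (ys : seq (nat * U)) N : (forall p, p \in ys -> (0 < p.1)%N) ->
  \sum_(n < N.+1) (size (mon ys n))%:R * t ^+ n <= \prod_(p <- ys) (1 - t ^+ p.1)^-1.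
Proof.
have /andP[t0 t1] := t01; have t0' := ltW t0.
elim: ys => [|[w y] ys IH] ys0.
  rewrite big_nil big_ord_recl /= expr0 mulr1 big1 ?addr0 // => i _.
  by rewrite mul0r.
have w0 : (0 < w)%N by apply: (ys0 (w, y)); rewrite inE eqxx.
have tw : 0 <= t ^+ w < 1 by rewrite exprn_ge0 // exprn_ilt1 // -lt0n.
have /andP[tw0 tw1] := tw.
pose c n : R := (size (mon ys n))%:R * t ^+ n.
have c0 n : 0 <= c n by rewrite mulr_ge0 // exprn_ge0.
have sizeE n : (n < N.+1)%N -> (size (mon ((w, y) :: ys) n))%:R * t ^+ n
    <= \sum_(a < N.+1) (t ^+ w) ^+ a * (if (a * w <= n)%N then c (n - a * w)%N else 0).
  move=> nN; rewrite mon_cons size_flatten /shape -!map_comp sumnE big_map big_filter.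
  rewrite natr_sum mulr_suml -/(index_iota 0 n.+1) big_mkcond big_mkord.
  rewrite (big_ord_widen N.+1 (fun a => if (a * w <= n)%N then (((size \o (fun a0 =>
    [seq y ^+ a0 * s | s <- mon ys (n - a0 * w)])) a)%:R : R) * t ^+ n else 0)) //.
  rewrite big_mkcond; apply: ler_sum => a _.
  case: ifP => an; last by rewrite mulr_ge0 ?exprn_ge0 //; case: ifP.
  case: ifP => awn; last by rewrite mulr0.
  by rewrite /= size_map /c mulrCA -exprM -exprD [(w * a)%N]mulnC subnKC.
rewrite big_cons.
have le1 : \sum_(n < N.+1) (size (mon ((w, y) :: ys) n))%:R * t ^+ n
    <= \sum_(a < N.+1) (t ^+ w) ^+ a * \sum_(n < N.+1) c n.
  apply: le_trans (_ : _ <= \sum_(n < N.+1) \sum_(a < N.+1) (t ^+ w) ^+ a * (if (a * w <=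
    n)%N then c (n - a * w)%N else 0)) _.
    by apply: ler_sum => n _; exact: sizeE.
  rewrite exchange_big; apply: ler_sum => a _ /=; rewrite -mulr_sumr.
  apply: ler_wpM2l; first exact: exprn_ge0.
  have [aN|Na] := leqP (a * w) N; last first.
    rewrite big1 => [|n _]; first exact: sumr_ge0.
    by rewrite leqNgt (leq_ltn_trans (ltn_ord n : (n <= N)%N) Na).
  have -> : \sum_(n < N.+1) (if (a * w <= n)%N then c (n - a * w)%N else 0)
      = \sum_(k < N.+1 - a * w) c k.
    rewrite -(sum_shift c (a * w)) subnKC //; exact: leqW.
  rewrite (big_ord_widen N.+1 c) ?leq_subr // big_mkcond.
  by apply: ler_sum => k _; case: ifP.
apply: le_trans le1 _; rewrite -mulr_suml; apply: ler_pM => //.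
- by apply: sumr_ge0 => a _; exact: exprn_ge0.
- exact: sumr_ge0.
- exact: geometric_le.
- by apply: IH => p pys; apply: ys0; rewrite inE pys orbT.
Qed.

(** For x = t^w <= t one has 1 / (1 - x) = 1 + x / (1 - x) <= exp (x / (1 - t)). The count is thus
    controlled by the weight series of the letters, however many there are. *)
Lemma mon_count_exp (ys : seq (nat * U)) N : (forall p, p \in ys -> (0 < p.1)%N) ->
  \sum_(n < N.+1) (size (mon ys n))%:R * t ^+ n
    <= expR ((\sum_(p <- ys) t ^+ p.1) / (1 - t)).
Proof.
move=> ys0; have /andP[t0 t1] := t01; apply: le_trans (mon_count N ys0) _.
rewrite mulr_suml expR_sum big_seq [leRHS]big_seq; apply: ler_prod => p pys.
have p0 := ys0 _ pys.
have tp : t ^+ p.1 <= t by rewrite -[leRHS]expr1 ler_wiXn2l // ltW.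
have tp0 : 0 <= t ^+ p.1 by rewrite exprn_ge0 // ltW.
have s0 : 0 < 1 - t ^+ p.1 by lra.
rewrite invr_ge0 (ltW s0) /=; apply: le_trans (expR_ge1Dx _).
have t1' : 0 < 1 - t by lra.
have -> : (1 - t ^+ p.1)^-1 = 1 + t ^+ p.1 / (1 - t ^+ p.1).
  have s1 := lt0r_neq0 s0; apply: (mulIf s1).
  by rewrite mulVf // mulrDl mul1r mulfVK // subrK.
by rewrite lerD2l ler_wpM2l // lef_pV2 // lerB.
Qed.

End MonomialCount.

Lemma digits_inj d B (f g : 'I_d -> nat) :
  (forall i, f i < B)%N -> (forall i, g i < B)%N ->
  (\sum_i f i * B ^ i = \sum_i g i * B ^ i)%N -> f =1 g.
Proof.
elim: d f g => [|d IH] f g fB gB; first by move=> _ [].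
have B0 : (0 < B)%N by exact: leq_ltn_trans (fB ord0).
have shift (h : 'I_d.+1 -> nat) : (\sum_i h i * B ^ i
    = h ord0 + B * \sum_(i < d) h (lift ord0 i) * B ^ i)%N.
  rewrite big_ord_recl expn0 muln1 big_distrr; congr (_ + _)%N.
  by apply: eq_bigr => i _; rewrite lift0 expnS mulnCA.
rewrite !shift ![(_ + B * _)%N]addnC ![(B * _)%N]mulnC => e i.
have e0 : f ord0 = g ord0.
  by have := congr1 (modn^~ B) e; rewrite !modnMDl !modn_small.
have e1 : (\sum_(i < d) f (lift ord0 i) * B ^ i = \sum_(i < d) g (lift ord0 i) * B ^ i)%N.
  by have := congr1 (divn^~ B) e; rewrite !divnMDl // !divn_small // !addn0.
have [j ->|-> //] := unliftP ord0 i.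
by apply: (IH (fun k => f (lift ord0 k)) (fun k => g (lift ord0 k))).
Qed.

(** Base 3 is chosen because two indices have multiplicities at most 2, which can then be read off
    as digits. *)
Lemma pow3_sum_inj d (a b a' b' : 'I_d) :
  (3 ^ a + 3 ^ b = 3 ^ a' + 3 ^ b')%N -> (a = a' /\ b = b') \/ (a = b' /\ b = a').
Proof.
pose f (a b i : 'I_d) : nat := ((i == a) + (i == b))%N.
have fE (a1 b1 : 'I_d) : (3 ^ a1 + 3 ^ b1 = \sum_(i < d) f a1 b1 i * 3 ^ i)%N.
  under eq_bigr => i _ do rewrite mulnDl.
  rewrite big_split /= (bigD1 a1) //= eqxx mul1n big1 ?addn0; last by move=> i /negbTE->.
  by rewrite (bigD1 b1) //= eqxx mul1n big1 ?addn0 // => i /negbTE->.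
have f3 a1 b1 i : (f a1 b1 i < 3)%N by rewrite /f; case: (i == a1); case: (i == b1).
rewrite !fE => /(digits_inj (f3 _ _) (f3 _ _)) e.
have := e a; have := e b; rewrite /f !eqxx => eb ea.
have [aa|aa] := eqVneq a a'.
  left; split=> //; move: eb; rewrite aa => /eqP; rewrite eqn_add2l.
  by case: (eqVneq b b').
move: ea; rewrite (negbTE aa); have [ab|//] := eqVneq a b'.
move=> _; right; split=> //; move: eb; rewrite -ab addnC => /eqP; rewrite eqn_add2r.
by case: (eqVneq b a').
Qed.

(** * Comparison with the polynomial ring *)

Section LowerBound.
Variables (F : fieldType) (L : lieAlgType F) (gr : nat -> submodClosed L).
Hypothesis hgr : graded_lie gr.
Variables (U : algType F) (iota : {linear L -> U}).
Hypothesis hU : is_enveloping_algebra iota.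
Local Notation Ugr := (enveloping_grading iota gr).
Hypothesis hA : graded_alg Ugr.
Variables (u : nat -> nat) (d : nat) (e : 'I_d -> L).
Hypothesis Udim : forall n, has_dim (Ugr n) (u n).
Hypothesis eB : is_basis (gr 1%N) e.

Lemma Ugr_exp k (x : U) : x \in Ugr 1%N -> x ^+ k \in Ugr k.
Proof.
move=> x1; elim: k => [|k IH]; first by rewrite expr0; exact: graded_alg1 hA.
by rewrite exprS -add1n; exact: (graded_algM hA).
Qed.

Lemma Ugr_prod n (f : 'I_n -> nat) (x : 'I_n -> U) :
  (forall i, x i \in Ugr (f i)) -> \prod_i x i \in Ugr (\sum_i f i)%N.
Proof.
elim: n f x => [|n IH] f x xf; first by rewrite !big_ord0; exact: graded_alg1 hA.
by rewrite !big_ord_recl; apply: (graded_algM hA) => //; exact: IH.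
Qed.

Lemma iota_e i : iota (e i) \in Ugr 1%N.
Proof. by apply: Ugr_iota; case: eB. Qed.

Lemma monomial_card_le K n :
  (#|[pred f : {ffun 'I_d -> 'I_K} | (\sum_i f i)%N == n]| <= u n)%N.
Proof.
have [g gE] := poly_rep hgr hU eB (fun i => K ^ i)%N.
pose P := [pred f : {ffun 'I_d -> 'I_K} | (\sum_i f i)%N == n].
pose v (f : {f | P f}) : U := \prod_i iota (e i) ^+ (val f i).
rewrite -card_sig; apply: (indep_le_dim (Udim n) (w := v)) => [f|c c0 f0].
  by have /eqP <- := valP f; apply: Ugr_prod => i; apply: Ugr_exp; exact: iota_e.
have gv f : g (v f) = 'X^(\sum_i val f i * K ^ i)%N.
  rewrite rmorph_prod -prodrXr; apply: eq_bigr => i _.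
  by rewrite rmorphXn /= gE -exprM mulnC.
have := congr1 (fun x => (g x)`_(\sum_i val f0 i * K ^ i)%N) c0.
rewrite raddf0 coef0 raddf_sum coef_sum (bigD1 f0) //= [X in _ + X = _]big1 => [|f ff0].
  by rewrite linearZ /= gv coefZ coefXn eqxx mulr1 addr0.
rewrite linearZ /= gv coefZ coefXn; case: eqP => [eqf|_]; last by rewrite mulr0.
case/eqP: ff0; apply/val_inj/ffunP => i; apply: val_inj.
by apply: (digits_inj _ _ (esym eqf)) => j; exact: ltn_ord.
Qed.

(** Expanding the power gives one term per exponent vector with entries below [K]; its total degree
    is at most [d * K], whence the range on the right. *)
Lemma monomial_series_le (R : realType) (t : R) K : 0 < t < 1 ->
  (\sum_(k < K) t ^+ k) ^+ d <= \sum_(n < (d * K).+1) (u n)%:R * t ^+ n.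
Proof.
move=> /andP[t0 t1].
have -> : (\sum_(k < K) t ^+ k) ^+ d = \sum_(f : {ffun 'I_d -> 'I_K}) t ^+ (\sum_i f i)%N.
  rewrite -[in LHS](card_ord d) -prodr_const bigA_distr_bigA /=.
  by apply: eq_bigr => f _; rewrite prodrXr.
have fd (f : {ffun 'I_d -> 'I_K}) : (\sum_i f i < (d * K).+1)%N.
  rewrite ltnS -[X in (_ <= X * _)%N]card_ord -sum_nat_const leq_sum // => i _.
  exact: ltnW.
rewrite (partition_big (fun f => Ordinal (fd f)) xpredT) //=; apply: ler_sum => n _.
rewrite (eq_bigr (fun=> t ^+ n)); last by move=> f /eqP <-.
rewrite sumr_const -[X in X <= _]mulr_natl ler_wpM2r ?exprn_ge0 ?(ltW t0) // ler_nat.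
exact: monomial_card_le.
Qed.

(** In the polynomial ring the coefficient of x_k x_l becomes C k l + C l k, and that of a square
    becomes C k k. Reading squares separately gives the diagonal in characteristic 2 as well. *)
Lemma relation_antisym (C : 'I_d -> 'I_d -> F) :
  \sum_k \sum_l C k l *: (iota (e k) * iota (e l)) = 0 ->
  (forall k, C k k = 0) /\ forall k l, C k l = - C l k.
Proof.
move=> C0; have [g gE] := poly_rep hgr hU eB (fun i => 3 ^ i)%N.
have Cg a b : \sum_k \sum_l C k l * ((3 ^ a + 3 ^ b)%N == (3 ^ k + 3 ^ l)%N)%:R = 0.
  have := congr1 (fun x => (g x)`_(3 ^ a + 3 ^ b)%N) C0.
  rewrite raddf0 coef0 raddf_sum coef_sum => Ce; rewrite -[RHS]Ce; apply: eq_bigr => k _.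
  rewrite raddf_sum coef_sum; apply: eq_bigr => l _.
  by rewrite [in RHS]/= linearZ /= rmorphM /= !gE -exprD coefZ coefXn.
have Ckk k : C k k = 0.
  rewrite -[RHS](Cg k k) (bigD1 k) //= (bigD1 k) //= eqxx mulr1.
  rewrite [X in _ + X + _]big1 => [|l lk]; last first.
    by case: eqP => [/pow3_sum_inj[[_ kl]|[kl _]]|_];
      [rewrite kl eqxx in lk | rewrite kl eqxx in lk | rewrite mulr0].
  rewrite [X in _ + X]big1 ?addr0 // => k' kk; rewrite big1 // => l _.
  by case: eqP => [/pow3_sum_inj[[kl _]|[_ kl]]|_];
    [rewrite kl eqxx in kk | rewrite kl eqxx in kk | rewrite mulr0].
split=> // k l; have [->|kl] := eqVneq k l; first by rewrite Ckk oppr0.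
apply/eqP; rewrite -addr_eq0; apply/eqP; rewrite -[RHS](Cg k l).
have inner k' : \sum_l' C k' l' * ((3 ^ k + 3 ^ l)%N == (3 ^ k' + 3 ^ l')%N)%:R
    = if k' == k then C k l else if k' == l then C l k else 0.
  have [->|k'k] := eqVneq k' k.
    rewrite (bigD1 l) //= eqxx mulr1 big1 ?addr0 // => l' ll.
    case: eqP => [/pow3_sum_inj[[_ ll']|[kl' lk]]|_]; rewrite ?mulr0 //.
      by rewrite ll' eqxx in ll.
    by rewrite lk eqxx in kl.
  have [->|k'l] := eqVneq k' l.
    rewrite (bigD1 k) //= [(3 ^ l + _)%N]addnC eqxx mulr1 big1 ?addr0 // => l' ll.
    case: eqP => [/pow3_sum_inj[[kl' _]|[kl' _]]|_]; rewrite ?mulr0 //.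
      by rewrite kl' eqxx in kl.
    by rewrite kl' eqxx in ll.
  rewrite big1 // => l' _.
  case: eqP => [/pow3_sum_inj[[kl' _]|[_ kl']]|_]; rewrite ?mulr0 //.
    by rewrite kl' eqxx in k'k.
  by rewrite kl' eqxx in k'l.
under eq_bigr => k' _ do rewrite inner.
have lk : l != k by rewrite eq_sym.
rewrite (bigD1 k) //= eqxx (bigD1 l) //= (negbTE lk) eqxx.
by rewrite addrA big1 ?addr0 // => k' /andP[/negbTE -> /negbTE ->].
Qed.

(** Products e_k e_l with k <= l are independent by [relation_antisym], and the dimension formula
    says that there are [u 2] of them, so they span degree two. It remains to expand a commutator in
    this basis. *)
Lemma iota_commute : (u 2 + 'C(d, 2) = d * d)%N ->
  forall x y, x \in gr 1%N -> y \in gr 1%N -> iota x * iota y = iota y * iota x.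
Proof.
move=> u2; pose P := [pred ij : 'I_d * 'I_d | (ij.1 <= ij.2)%N].
pose v (ij : {ij | P ij}) : U := iota (e (val ij).1) * iota (e (val ij).2).
have vU ij : v ij \in Ugr 2 by exact: (graded_algM hA (iota_e _) (iota_e _)).
have combE (c : {ij | P ij} -> F) : exists C : 'I_d -> 'I_d -> F,
    (forall k l : 'I_d, (l < k)%N -> C k l = 0) /\ (forall ij, C (val ij).1 (val ij).2
      = c ij) /\
    \sum_ij c ij *: v ij = \sum_k \sum_l C k l *: (iota (e k) * iota (e l)).
  pose C k l := if insub (k, l) is Some ij then c ij else 0.
  exists C; split=> [k l lk|].
    by rewrite /C insubF //=; apply/negbTE; rewrite -ltnNge.
  have Cv ij : C (val ij).1 (val ij).2 = c ij.
    by rewrite /C -surjective_pairing valK.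
  split=> //; rewrite pair_big /=.
  rewrite (bigID P) /= [X in _ = _ + X]big1 ?addr0 => [|[k l] /= kl]; last first.
    by rewrite /C insubF ?scale0r //; apply/negbTE.
  rewrite (reindex_omap (val : {ij | P ij} -> _) insub) /=; last by move=> ij Pij;
    rewrite insubT.
  apply: eq_big => [ij|ij _]; last by rewrite Cv.
  by rewrite valK eqxx andbT; case: ij.
have vI : indep v.
  move=> c c0 ij; have [C [Clow [Cc CE]]] := combE c.
  have [Ckk Ckl] := relation_antisym (etrans (esym CE) c0).
  rewrite -Cc; have := valP ij; case: (val ij) => k l /= kl.
  move: kl; rewrite leq_eqVlt => /orP[/eqP/val_inj ->|kl]; first exact: Ckk.
  by rewrite Ckl Clow ?oppr0.
have vcard : (u 2 <= #|{: {ij | P ij}}|)%N.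
  rewrite card_sig -(leq_add2r #|[predC P]|) cardC card_prod card_ord -u2 leq_add2l.
  rewrite -bin2_sum big_mkord -sum1_card.
  rewrite (eq_bigl (fun kl : 'I_d * 'I_d => (kl.2 < kl.1)%N)); last first.
    by move=> kl; rewrite inE /= -ltnNge.
  rewrite -(pair_big_dep xpredT (fun k l : 'I_d => (l < k)%N) (fun _ _ => 1%N)) /=.
  apply: leq_sum => k _; rewrite -(big_ord_widen d (fun=> 1%N)); last exact: ltnW.
  by rewrite sum1_card card_ord.
have vG x : x \in Ugr 2 -> lincomb v x.
  move=> xU; apply: contrapT => nx.
  have := indep_le_dim (Udim 2) _ (indep_extend1 vI nx).
  rewrite card_sum card_unit => H; suff : (#|{: {ij | P ij}}| + 1 <= u 2)%N by lia.
  by apply: H => -[i|].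
have ecomm a b : iota (e a) * iota (e b) = iota (e b) * iota (e a).
  apply/eqP; rewrite -subr_eq0; apply/eqP.
  have [|c cE] := vG (iota (e a) * iota (e b) - iota (e b) * iota (e a)).
    by apply: submodB; exact: (graded_algM hA (iota_e _) (iota_e _)).
  have [->|ab] := eqVneq a b; first by rewrite subrr.
  have [C [Clow [Cc CE]]] := combE c.
  (* [D] is a relation, hence antisymmetric, and differs from [C] by antisymmetric coefficients. So
     [C] is antisymmetric and upper triangular, hence zero. *)
  pose D k l := C k l - (((k == a) && (l == b))%:R - ((k == b) && (l == a))%:R).
  have delta a' b' : \sum_k \sum_l ((k == a') && (l == b'))%:R *: (iota (e k) * iota (e l))
      = iota (e a') * iota (e b').
    rewrite (bigD1 a') //= (bigD1 b') //= !eqxx scale1r.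
    rewrite [X in _ + X + _]big1 => [|l /negbTE lb]; last by rewrite lb scale0r.
    rewrite [X in _ + X]big1 ?addr0 // => k /negbTE ka.
    by rewrite big1 // => l _; rewrite ka scale0r.
  have [|Dkk Dkl] := relation_antisym (C := D).
    under eq_bigr => k _ do (under eq_bigr => l _ do rewrite !scalerBl; rewrite !sumrB).
    by rewrite !sumrB !delta -CE -cE subrr.
  have C0 k l : C k l = 0.
    have [lk|] := ltnP l k; first exact: Clow.
    rewrite leq_eqVlt => /orP[/eqP/val_inj ->|kl].
      have := Dkk l; rewrite /D.
      have nab : (l == a) && (l == b) = false.
        by apply/negbTE; apply: contra ab => /andP[/eqP <- /eqP <-].
      by rewrite [(l == b) && _]andbC nab !subr0.
    have := Dkl k l; rewrite /D (Clow l k kl) sub0r opprK.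
    rewrite [(l == a) && _]andbC [(l == b) && _]andbC opprB.
    by rewrite -[RHS]add0r => /addIr.
  rewrite cE CE big1 // => k _; rewrite big1 // => l _.
  by rewrite C0 scale0r.
have [_ _ eG] := eB.
move=> x y /eG[c ->] /eG[c' ->]; rewrite !linear_sum !big_distrlr exchange_big /=.
apply: eq_bigr => j _; apply: eq_bigr => i _.
by rewrite !linearZ /= -!scalerAl -!scalerAr ecomm !scalerA mulrC.
Qed.

End LowerBound.

(** * Growth of the enveloping algebra *)

Section UpperBound.
Variables (F : fieldType) (L : lieAlgType F) (gr : nat -> submodClosed L).
Hypothesis hgr : graded_lie gr.
Variables (U : algType F) (iota : {linear L -> U}).
Hypothesis hU : is_enveloping_algebra iota.
Local Notation Ugr := (enveloping_grading iota gr).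

(** The image of [gr k] is counted instead of [gr k]: it lies in [Ugr k], which is
    finite-dimensional in the Koszul case, while injectivity of [iota] is proved only in degrees 1
    and 2. *)
Definition iota_comp k : {pred U} := fun u => `[< exists2 x, x \in gr k & iota x = u >].

Variable l : nat -> nat.
Variable v : forall k, 'I_(l k) -> U.
Hypothesis vB : forall k, is_basis (iota_comp k) (@v k).

Definition iota_block k : seq (nat * U) := [seq (k, v i) | i <- enum 'I_(l k)].
Definition iota_list N : seq (nat * U) := flatten [seq iota_block k | k <- seq.iota 1 N].

Lemma iota_listP N p : p \in iota_list N <->
  exists k (i : 'I_(l k)), (1 <= k <= N)%N /\ p = (k, v i).
Proof.
split=> [/flatten_mapP[k]|[k [i [kN ->]]]].
  by rewrite mem_iota add1n ltnS => kN /mapP[i _ ->]; exists k, i.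
apply/flatten_mapP; exists k; first by rewrite mem_iota add1n ltnS.
by apply: map_f; rewrite mem_enum.
Qed.

Lemma iota_list_sorted N : pairwise (fun p q : nat * U => (p.1 <= q.1)%N) (iota_list N).
Proof.
rewrite /iota_list; elim: N 1%N => // N IH m /=.
rewrite pairwise_cat IH andbT; apply/andP; split.
  apply/allrelP => p q /mapP[i _ ->] /flatten_mapP[k].
  by rewrite mem_iota => /andP[mk _] /mapP[j _ ->] /=; exact: ltnW.
rewrite /iota_block pairwise_map; elim: (enum _) => //= i s ->; rewrite andbT.
by apply/allP => j _ /=.
Qed.

Lemma iota_comp_span N k u : (1 <= k <= N)%N -> u \in iota_comp k ->
  u \in lin_span [set z | (k, z) \in iota_list N].
Proof.
move=> kN; have [_ _ vG] := vB k => /vG[c ->]; apply: rpred_sum => i _; apply: rpredZ.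
by apply: lin_span_gen; apply/iota_listP; exists k, i.
Qed.

Lemma iota_list_comm N p q : p \in iota_list N -> q \in iota_list N -> (p.1 + q.1 <= N)%N ->
  p.2 * q.2 - q.2 * p.2 \in lin_span [set z | (p.1 + q.1, z)%N \in iota_list N].
Proof.
move=> /iota_listP[k [i [kN ->]]] /iota_listP[k' [i' [kN' ->]]] /= kkN.
have [vk _ _] := vB k; have [vk' _ _] := vB k'.
have /asboolP[x xk <-] := vk i; have /asboolP[x' xk' <-] := vk' i'.
rewrite -(iota_lie hU); apply: iota_comp_span; first by lia.
by apply/asboolP; exists (lie x x') => //; exact: (graded_lie_lie hgr).
Qed.

(** Words of degree [n <= N] have letters of weight at most [N], so a single finite list serves all
    degrees up to [N]. *)
Lemma Ugr_mon_span N n x : (n <= N)%N -> x \in Ugr n -> x \in mon_span (iota_list N) n.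
Proof.
move=> nN; apply: lin_span_min => _ [s [sg sn ->]].
have [s0|s0] := boolP (has (fun p => p.1 == 0%N) s).
  by rewrite (prod_eq0 hgr _ sg s0) rpred0.
pose s' := [seq (p.1, iota p.2) | p <- s].
have s'n : sumn [seq p.1 | p <- s'] = n by rewrite -map_comp.
have -> : \prod_(p <- s) iota p.2 = \prod_(p <- s') p.2 by rewrite big_map.
rewrite -s'n; apply: (@mon_span_prod _ _ N) => //.
- by move=> p /iota_listP[k [i [/andP[k0 _] ->]]].
- exact: iota_list_sorted.
- exact: iota_list_comm.
- move=> _ /mapP[p ps ->] /=; apply: iota_comp_span.
    apply/andP; split.
      by rewrite lt0n; apply: contra s0 => p0; apply/hasP; exists p.
    rewrite (leq_trans _ nN) // -sn; elim: (s) ps => //= q r IH.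
    by rewrite inE => /orP[/eqP ->|/IH pr];
      [exact: leq_addr | exact: leq_trans (leq_addl _ _)].
  by apply/asboolP; exists p.2 => //; exact: sg.
- by rewrite s'n.
Qed.

Variable u : nat -> nat.
Hypothesis Udim : forall n, has_dim (Ugr n) (u n).

Lemma Ugr_series_bounded (R : realType) (t : R) : 0 < t < 1 ->
  (exists B, forall N, \sum_(k < N) (l k)%:R * t ^+ k <= B) ->
  exists B, forall N, \sum_(n < N) (u n)%:R * t ^+ n <= B.
Proof.
move=> t01 [B lB]; have /andP[t0 t1] := t01; exists (expR (B / (1 - t))) => N.
have t0' : 0 <= t by exact: ltW.
apply: le_trans (_ : \sum_(n < N.+1) (u n)%:R * t ^+ n <= _).
  by rewrite big_ord_recr /= lerDl mulr_ge0 // exprn_ge0.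
have Y0 : forall p, p \in iota_list N -> (0 < p.1)%N.
  by move=> p /iota_listP[k [i [/andP[k0 _] ->]]].
apply: le_trans (_ : \sum_(n < N.+1) (size (mon (iota_list N) n))%:R * t ^+ n <= _).
  apply: ler_sum => n _; rewrite ler_wpM2r ?exprn_ge0 // ler_nat.
  by apply: has_dim_le_seq (Udim n) => x; apply: Ugr_mon_span; exact: (ltn_ord n).
apply: le_trans (mon_count_exp t01 N Y0) _.
rewrite ler_expR ler_wpM2r ?invr_ge0 ?subr_ge0 ?(ltW t1) //.
apply: le_trans (lB N.+1).
rewrite /iota_list big_flatten big_map /= big_ord_recl.
rewrite (_ : \sum_(i < N) _ = \sum_(k <- seq.iota 1 N) (l k)%:R * t ^+ k).
  rewrite -[leLHS]add0r lerD //; first by rewrite mulr_ge0 // exprn_ge0.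
  apply: ler_sum => k _; rewrite big_map big_enum /= sumr_const card_ord.
  by rewrite -[X in X <= _]mulr_natl.
rewrite -[seq.iota 1 N]/(seq.iota (1 + 0) N) iotaDl big_map.
by rewrite -[in RHS](subn0 N) -/(index_iota 0 N) big_mkord.
Qed.

End UpperBound.

(** * Convergence from the entropy bound *)

Section Entropy.
Variables (R : realType) (F : fieldType) (L : lieAlgType F) (gr : nat -> submodClosed L).
Variables (U : algType F) (iota : {linear L -> U}).

Lemma iota_comp_le_edim k n : has_dim (iota_comp gr iota k) n ->
  ((n%:R)%:E <= edim R (gr k))%E.
Proof.
move=> [v [vI vF _]].
have /choice[w wP] : forall i, exists x, x \in gr k /\ iota x = v i.
  by move=> i; have /asboolP[x] := vI i; exists x.
apply: ereal_sup_ubound => /=; exists n, w; split=> // [i|c c0].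
  by have [] := wP i.
apply: vF; apply: etrans (linear0 iota); rewrite -[in RHS]c0 linear_sum.
by apply: eq_bigr => i _; rewrite linearZ /= (wP i).2.
Qed.

Lemma entropy_bound (r : R) : (entropy R gr <= 1)%E -> 1 < r ->
  exists N, forall n k, (N < n)%N -> has_dim (iota_comp gr iota n) k -> k%:R <= r ^+ n.
Proof.
move=> ent r1; have r0 : 0 < r by exact: lt_trans r1.
have : (entropy R gr < r%:E)%E by apply: le_lt_trans ent _; rewrite lte_fin.
(* The limsup is an infimum of suprema over neighbourhoods of infinity, so some [V] has supremum
   below [r]. The later strict bound [N < n] makes [n] positive, so the n-th root can be undone. *)
rewrite /entropy /limn_esup limf_esupE => /ereal_inf_lt[_ [V [N _ NV] <-] supV].
exists N => n k Nn kn; have n0 : (0 < n)%N by exact: leq_ltn_trans Nn.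
have edr : (edim R (gr n) `^ n%:R^-1 < r%:E)%E.
  apply: le_lt_trans supV; apply: ereal_sup_ubound; exists n => //.
  by apply: NV => /=; exact: ltnW.
have ke := iota_comp_le_edim kn.
have k0 : (0 <= (k%:R : R)%:E)%E by rewrite lee_fin.
have : ((k%:R : R)%:E `^ n%:R^-1 <= edim R (gr n) `^ n%:R^-1)%E.
  apply: gt0_ler_poweR => //; rewrite ?invr_ge0 // in_itv /= leey andbT //.
  exact: le_trans k0 ke.
move=> /le_lt_trans/(_ edr); rewrite poweR_EFin lte_fin => kr.
have -> : k%:R = (k%:R `^ n%:R^-1) ^+ n :> R.
  by rewrite -powR_mulrn ?powR_ge0 // -powRrM mulVf ?powRr1 // pnatr_eq0 -lt0n.
by apply: lerXn2r; rewrite ?nnegrE ?powR_ge0 ?(ltW r0) // ltW.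
Qed.

Lemma entropy_series_bounded (l : nat -> nat) (t : R) :
  (forall k, has_dim (iota_comp gr iota k) (l k)) -> (entropy R gr <= 1)%E -> 0 < t < 1 ->
  exists B, forall N, \sum_(k < N) (l k)%:R * t ^+ k <= B.
Proof.
(* The midpoint of 1 and 1 / t: it exceeds 1, as [entropy_bound] requires, while r t = (1 + t) / 2
   stays below 1 and gives a convergent geometric tail. *)
move=> lD ent /andP[t0 t1]; pose r := (1 + t^-1) / 2.
have ti : 1 < t^-1 by rewrite invf_gt1.
have r1 : 1 < r by rewrite /r; lra.
have rt : r * t = (t + 1) / 2.
  by rewrite /r mulrAC mulrDl mul1r mulVf // gt_eqF.
have [N0 bnd] := entropy_bound ent r1.
have t0' : 0 <= t by exact: ltW.
have x0 : 0 <= r * t by rewrite rt; lra.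
have x1 : r * t < 1 by rewrite rt; lra.
exists (\sum_(k < N0.+1) (l k)%:R * t ^+ k + (1 - r * t)^-1) => N.
have le1 : \sum_(k < N) (l k)%:R * t ^+ k <=
    \sum_(k < N) ((if (k < N0.+1)%N then (l k)%:R * t ^+ k else 0) + (r * t) ^+ k).
  apply: ler_sum => k _; case: ltnP => kN; first by rewrite lerDl exprn_ge0.
  by rewrite add0r exprMn ler_wpM2r ?exprn_ge0 //; exact: bnd.
apply: le_trans le1 _; rewrite big_split lerD //; last exact: geometric_le.
have pos k : 0 <= (l k)%:R * t ^+ k by rewrite mulr_ge0 // exprn_ge0.
pose c k : R := if (k < N0.+1)%N then (l k)%:R * t ^+ k else 0.
have c0 k : 0 <= c k by rewrite /c; case: ifP.
apply: le_trans (_ : \sum_(k < N + N0.+1) c k <= _).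
  by rewrite big_split_ord /= lerDl sumr_ge0.
by rewrite -big_mkcond -(big_ord_widen _ (fun k => (l k)%:R * t ^+ k) (leq_addl _ _)).
Qed.

End Entropy.

(** * Koszul Lie algebras of entropy at most one *)

Section KoszulLie.
Variables (F : fieldType) (L : lieAlgType F) (gr : nat -> submodClosed L).
Hypothesis hgr : graded_lie gr.
Variables (U : algType F) (iota : {linear L -> U}).
Hypothesis hU : is_enveloping_algebra iota.
Local Notation Ugr := (enveloping_grading iota gr).
Hypothesis hK : koszul_alg Ugr.

Let grZ k : zmod_closed (gr k). Proof. exact: submod_zmod_closed. Qed.
Let grG : is_grading (fun k => gr k). Proof. exact: graded_lie_sum hgr. Qed.
Local Notation pr := (gproj (fun k => gr k)).
Let hA : graded_alg Ugr := koszul_graded hK.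

Lemma Ugr_dims : exists u : nat -> nat, forall n, has_dim (Ugr n) (u n).
Proof.
have /choice[u uP] n : exists k, has_dim (Ugr n) k.
  by apply/fin_dimP; exact: koszul_finite_type hK n.
by exists u.
Qed.

(** [Ugr 1] consists of images of degree-one elements, and [iota_inj1] carries finite dimension back
    to L_1. *)
Lemma basis1 d : has_dim (Ugr 1%N) d ->
  exists e : 'I_d -> L, is_basis (gr 1%N) e /\ is_basis (Ugr 1%N) (iota \o e).
Proof.
move=> [v [vU vI vG]]; have /choice[e eP] i : exists x, x \in gr 1%N /\ iota x = v i.
  by have [x x1 ->] := Ugr1_iota hgr (vU i); exists x.
have ev : iota \o e = v by apply/funext => i; exact: (eP i).2.
exists e; rewrite ev; split; split=> // [i|c c0|x x1]; first exact: (eP i).1.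
- apply: vI; apply: etrans (linear0 iota); rewrite -[in RHS]c0 linear_sum.
  by apply: eq_bigr => i _; rewrite linearZ /= (eP i).2.
- have [c cE] := vG _ (Ugr_iota iota x1); exists c; apply/eqP; rewrite -subr_eq0; apply/eqP.
  apply: (iota_inj1 hgr hU).
    by apply: submodB => //; apply: rpred_sum => i _; rewrite rpredZ // (eP i).1.
  rewrite linearB cE linear_sum -sumrB big1 // => i _.
  by rewrite linearZ /= (eP i).2 subrr.
Qed.

Lemma koszul_dim2 (R : realType) (u : nat -> nat) (e : 'I_(u 1%N) -> L) :
  (entropy R gr <= 1)%E -> (forall n, has_dim (Ugr n) (u n)) ->
  is_basis (gr 1%N) e -> is_basis (Ugr 1%N) (iota \o e) ->
  (u 2 + 'C(u 1%N, 2) = u 1%N * u 1%N)%N.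
Proof.
move=> ent uP eB ieB.
have [eps epsE] := envelope_eps hU.
have eps_gr := @eps_Ugr _ _ gr _ iota _ epsE.
have gr0E := @Ugr0E _ _ _ hgr _ iota eps.
have hExt : forall s t, s <> t -> Ext_vanishes s t (ktriv_gmod eps_gr) (ktriv_gmod eps_gr).
  by move=> s t; apply: (koszul_Ext hK); exact: ktriv_trivial.
have [T [Tinj Trel]] := koszul_matrices hA gr0E uP hExt ieB.
(* Each entry of d d = 0 is a quadratic relation of [U], so its coefficients alternate; these are
   the hypotheses of [rank_eq0]. *)
have anti s i l := relation_antisym hgr hU eB (Trel s i l).
apply: (@u2E R u (syz_rank hA gr0E uP hExt) (u 1%N)) => //.
- exact: koszul_euler.
- case=> // s; rewrite ltnS => ds; apply: (rank_eq0 Tinj _ _ ds) => [s' k|s' k k'].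
    by apply/matrixP => i j; rewrite [RHS]mxE; exact: (anti s' i j).1.
  by apply/matrixP => i j; rewrite [RHS]mxE (anti s' i j).2.
- move=> t t01.
  have /choice[l lP] k : exists n, has_dim (iota_comp gr iota k) n.
    have sub : {subset iota_comp gr iota k <= Ugr k}.
      by move=> _ /asboolP[x xk <-]; exact: Ugr_iota.
    by have [n] := has_dim_sub sub (uP k); exists n.
  have vB k := svalP (cid (lP k)).
  apply: (Ugr_series_bounded hgr hU vB uP t01).
  exact: entropy_series_bounded lP ent t01.
- by move=> t K t01; exact: (monomial_series_le hgr hU hA uP eB).
Qed.

(** Generation in degree one enters here: composed with the surjection [pi], both maps are
    determined on the tensor algebra by their values on [Ugr 1]. *)
Lemma envelope_ext_uniq (B : algType F) (g h : {lrmorphism U -> B}) :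
  (forall x, x \in gr 1%N -> g (iota x) = h (iota x)) -> g =1 h.
Proof.
move=> gh; have [T [j [pi [jT pij piS _]]]] := koszul_quadratic hK.
have val_gh (v : subspace_type (Ugr 1%N)) : g (val v) = h (val v).
  by have [x x1 ->] := Ugr1_iota hgr (valP v); exact: gh.
have [f fE] : exists f : {linear subspace_type (Ugr 1%N) -> B}, forall v, f v = g (val v).
  by apply: linear_ex => a x y; rewrite !linearP.
have [_ uniq] := jT B f; move=> a; have [x <-] := piS a.
by have := uniq (g \o pi) (h \o pi); apply=> v /=; rewrite pij fE // val_gh.
Qed.

Lemma gr_ge2_eq0 : (forall x y, x \in gr 1%N -> y \in gr 1%N -> lie x y = 0) ->
  forall k x, (2 <= k)%N -> x \in gr k -> x = 0.
Proof.
move=> ab; elim/ltn_ind => k IH x k2 xk.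
have [p pE] := gproj_linear_ex grG k.
have [z zE] : exists z : {linear L -> L}, forall x, z x = 0.
  by apply: linear_ex => a u v; rewrite scaler0 addr0.
have [b b0] := bilin0_ex L L.
have [|u v|g gE] := nil3_rep hU (b := b) (f1 := z) (f2 := p); first by move=> *; rewrite zE.
  rewrite !b0 subrr pE; move: k2; rewrite leq_eqVlt => /orP[/eqP <-|k2].
    by rewrite gproj_lie2 // ab //; exact: (gproj_mem grZ grG).
  by apply: gproj_lie_gt2 => // j y /andP[j2 jk]; exact: IH.
(* The representation [h] kills all of [iota]. It agrees with [g] in degree one and therefore
   everywhere, so projection to degree [k] kills [x]. *)
have [||h hE] := nil3_rep hU (b := b) (f1 := z) (f2 := z).
- by move=> *; rewrite zE.
- by move=> *; rewrite !zE b0 subrr.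
have gh : g =1 h.
  apply: envelope_ext_uniq => y y1; rewrite gE hE !zE pE (gproj_id grZ grG _ y1).
  by rewrite gtn_eqF.
have := gh (iota x); rewrite gE hE !zE pE (gproj_id grZ grG _ xk) eqxx.
by case.
Qed.

End KoszulLie.

Theorem corollaryC (R : realType) (F : fieldType) (L : lieAlgType F)
    (gr : nat -> submodClosed L)
    (hgr : graded_lie gr) (hK : koszul_lie gr)
    (hent : (entropy R gr <= 1)%E) :
  fin_dim (fun _ : L => true) /\ abelian_lie L.
Proof.
have [U [iota [hU hA]]] := hK.
have [u uP] := Ugr_dims hA.
have [e [eB ieB]] := basis1 hgr hU (uP 1%N).
have u2 := koszul_dim2 hgr hU hA hent uP eB ieB.
have comm := iota_commute hgr hU (koszul_graded hA) uP eB u2.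
have ab x y : x \in gr 1%N -> y \in gr 1%N -> lie x y = 0.
  move=> x1 y1; apply: (iota_inj2 hgr hU eB); first exact: (graded_lie_lie hgr x1 y1).
  by rewrite (iota_lie hU) comm // subrr.
have gr2 := gr_ge2_eq0 hgr hU hA ab.
have grZ k : zmod_closed (gr k) by exact: submod_zmod_closed.
have grG := graded_lie_sum hgr.
(* Degree 0 is zero by the grading and higher degrees by [gr2], so L is L_1, which has dimension
   [u 1]. *)
have L1 x : x \in gr 1%N.
  have [n xE] := gproj_sum grZ grG x.
  rewrite (xE n) //; apply: rpred_sum => -[k /= _] _.
  case: k => [|[|k]]; first by rewrite gproj0_lie ?rpred0.
    exact: (gproj_mem grZ grG).
  by rewrite (gr2 _ _ _ (gproj_mem grZ grG x k.+2)) ?rpred0.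
split; last by move=> x y; exact: ab.
by apply/fin_dimP; exists (u 1%N), e; case: eB => eg eI eG; split=> // x _; exact: eG.
Qed.
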